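(* Let the $2\times2$ twist matrix $K$ have eigenvalues $\mathsf k_1,\mathsf k_2$ with $\mathsf k_1\neq\mathsf k_2$, $\mathsf k_1\ne0$, $\mathsf k_2\neq0$, and let $\mathsf k_1,\mathsf k_2$ and the inhomogeneities $\xi_1,\dots,\xi_N$ be generic (for almost any values of them). Let $\mathsf Q(\lambda)$ be the $Q$-operator of the model. Then for almost any choice of the co-vector $\langle L|\in\mathcal H^*$, the set of co-vectors $$\langle L|\prod_{n=1}^N\mathsf Q(\xi_n^{(h_n)}),\qquad h_n\in\{0,\dots,2s_n\},\ n\in\{1,\dots,N\},$$ is an SoV co-vector basis of $\mathcal H^*$. It coincides with the basis $$\langle h_1,\dots,h_N|=\langle S|\prod_{n=1}^N\frac{\mathsf k_2^{h_n-2s_n}\,\mathsf T^{(K|2s_n-h_n)}(\xi_n^{(2s_n)})}{\prod_{k=0}^{2s_n-h_n-1}d(\xi_n^{(2s_n-k)})}$$ once one fixes $$\langle L|=\langle S|\prod_{n=1}^N\mathsf Q(\xi_n^{(2s_n)})^{-1}.$$ Moreover, it coincides with Sklyanin's SoV basis when in addition $\langle S|=\langle2s_1,\dots,2s_N|_{Sk}$ (if $K_{12}\ne0$), respectively $\langle S|=\underline{\langle2s_1,\dots,2s_N|}_{Sk}$ (if $K_{12}=0$).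
   Context: Setting. Let $\eta\in\mathbb{C}\setminus\{0\}$, $N\ge1$, and let $s_1,\dots,s_N$ be spins with $2s_n\in\mathbb{Z}_{>0}$. Let $V_n=\mathbb{C}^{2s_n+1}$ and $\mathcal H=\bigotimes_{n=1}^N V_n$. On $V_n$ let $S_n^z=\mathrm{diag}(s_n,s_n-1,\dots,-s_n)$, let $S_n^+$ be the matrix with only nonzero entries $(S_n^+)_{j,j+1}=\sqrt{j(2s_n+1-j)}$, $1\le j\le 2s_n$, and let $S_n^-=(S_n^+)^t$. With auxiliary space $V_0=\mathbb{C}^2$, the Lax operator is $$\mathsf L_{0n}(\lambda)=\begin{pmatrix}\lambda+\eta(\tfrac12+S_n^z)&\eta S_n^-\\ \eta S_n^+&\lambda+\eta(\tfrac12-S_n^z)\end{pmatrix}_{[0]}.$$ For a $2\times2$ matrix $K=(K_{ij})$ and inhomogeneities $\xi_1,\dots,\xi_N\in\mathbb{C}$, the monodromy matrix is $$\mathsf M_0^{(K)}(\lambda)=K_0\mathsf L_{0N}(\lambda-\xi_N)\cdots\mathsf L_{01}(\lambda-\xi_1)=\begin{pmatrix}\mathsf A^{(K)}(\lambda)&\mathsf B^{(K)}(\lambda)\\\mathsf C^{(K)}(\lambda)&\mathsf D^{(K)}(\lambda)\end{pmatrix}_{[0]}$$ and the transfer matrix is $\mathsf T^{(K)}(\lambda)=\mathsf T^{(K|1)}(\lambda)=\mathrm{tr}_0\mathsf M_0^{(K)}(\lambda)$. Fused transfer matrices. For $l\ge1$, let $P^+_{1\dots l}$ be the projector onto symmetric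 tensors in $(\mathbb{C}^2)^{\otimes l}$, with image $V^+_{1\dots l}$. Set $\mathsf T^{(K|l)}(\lambda)=\mathrm{tr}_{V^+_{1\dots l}}\big[P^+_{1\dots l}\mathsf M^{(K)}_1(\lambda+(l-1)\eta)\cdots\mathsf M^{(K)}_l(\lambda)P^+_{1\dots l}\big]$ and $\mathsf T^{(K|0)}(\lambda)=1$. All these operators commute with each other. Notation. $\xi_n^{(k)}=\xi_n-\tfrac\eta2+(s_n-k)\eta$, $a(\lambda)=\prod_{n=1}^N(\lambda-\xi_n^{(2s_n)})$, $d(\lambda)=\prod_{n=1}^N(\lambda-\xi_n^{(0)})$. ''Almost any'' / ''generic'' means outside the zero set of some nonzero polynomial. Co-vectors are acted upon from the right. $Q$-operator. For generic parameters $\mathsf T^{(K)}(\lambda)$ is diagonalizable with simple spectrum. For each eigenvalue $t(\lambda)$ there is a polynomial $Q_t(\lambda)$ of degree at most $2\sum_ns_n$, unique up to normalization, with $Q_t(\xi_n^{(2s_n)})\neq0$ for all $n$ and $t(\lambda)Q_t(\lambda)=\mathsf k_1a(\lambda)Q_t(\lambda-\eta)+\mathsf k_2d(\lambda)Q_t(\lambda+\eta)$. Fix a point $\zeta$ in generic position and normalize $Q_t(\zeta)=1$. The $Q$-operator is defined by $\mathsf Q(\lambda)|t\rangle=Q_t(\lambda)|t\rangle$ on the eigenbasis of $\mathsf T^{(K)}$. It commutes with all transfer matrices, and $\mathsf Q(\xi_n^{(2s_n)})$ is invertible for all $n$. SoV basis. An SoV co-vector basis is a basis $\{\langle h_1,\dots,h_N|\}$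 of $\mathcal H^*$ in which the wavefunctions of the transfer matrix eigenvectors factorize: up to normalization of $|t\rangle$, $\langle h_1,\dots,h_N|t\rangle=\prod_nQ_t(\xi_n^{(h_n)})$. Sklyanin's bases. Let $\langle0|=\bigotimes_n(1,0,\dots,0)\in\mathcal H^*$. If $K_{12}\ne0$, $\langle h_1,\dots,h_N|_{Sk}=\langle0|\prod_{n=1}^N\prod_{k=0}^{h_n-1}\frac{\mathsf A^{(K)}(\xi_n^{(k)})}{\mathsf k_1a(\xi_n^{(k)})}$. If $K_{12}=0$, choose an invertible $2\times 2$ matrix $W$ such that $\bar K=W^{-1}KW$ has $\bar K_{12}\neq0$, $\bar K_{21}\ne0$. Let $\mathcal W=\bigotimes_nW_n^{(2s_n)}$, where $W_n^{(2s_n)}$ is the action of $W^{\otimes2s_n}$ on $\mathrm{Sym}^{2s_n}(\mathbb{C}^2)\simeq V_n$ (the $j$-th basis vector of $V_n$ corresponds to the normalized symmetric tensor with $2s_n+1-j$ factors $e_1$ and $j-1$ factors $e_2$). Then $\underline{\langle h_1,\dots,h_N|}_{Sk}=\langle0|\prod_{n=1}^N\prod_{k=0}^{h_n-1}\frac{\mathsf A^{(\bar K)}(\xi_n^{(k)})}{\mathsf k_1a(\xi_n^{(k)})}\mathcal W^{-1}$. *)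

(* Defs.v *)
From HB Require Import structures.
From mathcomp Require Import all_boot all_order all_algebra perm.
From mathcomp.multinomials Require Import mpoly.

Set Implicit Arguments.
Unset Strict Implicit.
Unset Printing Implicit Defensive.

Import GRing.Theory Num.Theory.
Local Open Scope ring_scope.

(* "For almost any x": outside the zero set of some nonzero polynomial. *)
Definition almost_any (C : numClosedFieldType) (n : nat)
    (P : ('I_n -> C) -> Prop) : Prop :=
  exists2 p : {mpoly C[n]}, p != 0 & forall x, p.@[x] != 0 -> P x.

Section LocalOperators.
Variable C : numClosedFieldType.

(* Spin s = m / 2 on C^(m+1).  Indices start at 0, so index i below is the
   index j = i + 1 of the usual 1-based presentation. *)
Definition Sz (m : nat) : 'M[C]_m.+1 :=
  diag_mx (\row_(i < m.+1) (m%:R / 2 - i%:R)).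

Definition Splus (m : nat) : 'M[C]_m.+1 :=
  \matrix_(i < m.+1, j < m.+1)
    if (j : nat) == i.+1 then sqrtC (i.+1 * (m - i))%:R else 0.

Definition Sminus (m : nat) : 'M[C]_m.+1 := (Splus m)^T.

(* W^{(x) m} on (C^2)^{(x) m}: matrix coefficients between the tensors
   e_{f 0} (x) ... (x) e_{f (m-1)}. *)
Definition tens_pow_coef (m : nat) (W : 'M[C]_2) (f g : {ffun 'I_m -> 'I_2}) : C :=
  \prod_(k < m) W (f k) (g k).

(* Coefficient on e_f of the unit-norm symmetric tensor having i factors e_2
   and m - i factors e_1 (e_1, e_2 are the indices 0, 1 of 'I_2). *)
Definition sym_tens_coef (m : nat) (i : 'I_m.+1) (f : {ffun 'I_m -> 'I_2}) : C :=
  if #|[set k | f k == 1]| == i then (sqrtC 'C(m, i)%:R)^-1 else 0.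

(* The symmetric tensors above are orthonormal with real coefficients, so this
   is the matrix of W^{(x) m} restricted to Sym^m(C^2) in that basis. *)
Definition sym_pow (m : nat) (W : 'M[C]_2) : 'M[C]_m.+1 :=
  \matrix_(i < m.+1, j < m.+1)
    \sum_(f : {ffun 'I_m -> 'I_2}) \sum_(g : {ffun 'I_m -> 'I_2})
      sym_tens_coef i f * tens_pow_coef W f g * sym_tens_coef j g.

(* Projector onto symmetric tensors of (C^2)^{(x) l}: (1 / l!) times the sum
   over s in S_l of the operator permuting the factors by s. *)
Definition sym_proj (l : nat) (f g : {ffun 'I_l -> 'I_2}) : C :=
  (l`!%:R)^-1 * \sum_(s : 'S_l) ([forall i, f (s i) == g i])%:R.

End LocalOperators.

Section Chain.
Variable C : numClosedFieldType.
(* m n = 2 s_n *)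
Variables (N : nat) (m : 'I_N -> nat).

(* Labels (h_1, ..., h_N) with 0 <= h_n <= 2 s_n.  They index both the tensor
   basis of the quantum space and the separation of variables bases. *)
Definition label : finType := {dffun forall n : 'I_N, 'I_(m n).+1}.

Definition label_max : label := finfun (fun n : 'I_N => (ord_max : 'I_(m n).+1)).

(* The quantum space is C^qdim, with the tensor basis enumerated by label. *)
Definition qdim : nat := #|label|.

Definition tens_row (u : forall n : 'I_N, 'rV[C]_((m n).+1)) : 'rV[C]_qdim :=
  \row_j \prod_(n < N) u n 0 ((enum_val j : label) n).

Definition tens_mx (A : forall n : 'I_N, 'M[C]_((m n).+1)) : 'M[C]_qdim :=
  \matrix_(i, j) \prod_(n < N)
    A n ((enum_val i : label) n) ((enum_val j : label) n).

(* A acting on the n-th factor, the identity on the others *)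
Definition site (n : 'I_N) (A : 'M[C]_((m n).+1)) : 'M[C]_qdim :=
  tens_mx (dfwith (fun k : 'I_N => (1%:M : 'M[C]_((m k).+1))) A).

(* <0| *)
Definition covac : 'rV[C]_qdim :=
  tens_row (fun n => delta_mx 0 0).

Definition gauge (W : 'M[C]_2) : 'M[C]_qdim :=
  tens_mx (fun n => sym_pow (m n) W).

Variables (eta : C) (xi : 'I_N -> C).

(* Operators on C^2 (x) H are 2 x 2 matrices with entries in End(H). *)
Definition Lax (n : 'I_N) (la : C) : 'M['M[C]_qdim]_2 :=
  \matrix_(i < 2, j < 2)
    if i == 0 then
      if j == 0 then site ((la + eta / 2)%:M + eta *: Sz C (m n))
      else site (eta *: Sminus C (m n))
    else
      if j == 0 then site (eta *: Splus C (m n))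
      else site ((la + eta / 2)%:M - eta *: Sz C (m n)).

Definition monodromy (K : 'M[C]_2) (la : C) : 'M['M[C]_qdim]_2 :=
  map_mx (fun c : C => c%:M : 'M[C]_qdim) K *
  \prod_(n < N) Lax (rev_ord n) (la - xi (rev_ord n)).

Definition opA (K : 'M[C]_2) (la : C) : 'M[C]_qdim := monodromy K la 0 0.

Definition transfer (K : 'M[C]_2) (la : C) : 'M[C]_qdim :=
  \tr (monodromy K la).

(* Matrix coefficient, with values in End(H), of the product
   M_1(la + (l-1) eta) ... M_l(la) over l auxiliary spaces *)
Definition monodromies (K : 'M[C]_2) (l : nat) (la : C)
    (f g : {ffun 'I_l -> 'I_2}) : 'M[C]_qdim :=
  \prod_(i < l) monodromy K (la + (l.-1 - i)%:R * eta) (f i) (g i).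

(* The trace over V^+ of P^+ X P^+ equals its trace over the whole of
   (C^2)^{(x) l}. *)
Definition fused_transfer (K : 'M[C]_2) (l : nat) (la : C) : 'M[C]_qdim :=
  if l == 0%N then 1%:M else
  \sum_(f : {ffun 'I_l -> 'I_2}) \sum_(g : {ffun 'I_l -> 'I_2})
    \sum_(h : {ffun 'I_l -> 'I_2})
      (sym_proj C f g * sym_proj C h f) *: monodromies K la g h.

(* xi_n^(k) *)
Definition xish (n : 'I_N) (k : nat) : C :=
  xi n - eta / 2 + ((m n)%:R / 2 - k%:R) * eta.

Definition afun (la : C) : C := \prod_(n < N) (la - xish n (m n)).
Definition dfun (la : C) : C := \prod_(n < N) (la - xish n 0).

(* v is a common eigenvector of all the T(la), with eigenvalue t(la) *)
Definition transfer_eigenvector (K : 'M[C]_2) (t : {poly C}) (v : 'cV[C]_qdim) :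
    Prop :=
  v != 0 /\ forall la, transfer K la *m v = t.[la] *: v.

(* An eigenbasis of T in which the eigenvalues are pairwise distinct
   functions: T is diagonalizable with simple spectrum. *)
Definition transfer_eigenbasis (K : 'M[C]_2) (t : label -> {poly C})
    (e : label -> 'cV[C]_qdim) : Prop :=
  [/\ basis_of fullv (codom e), injective t &
      forall i, transfer_eigenvector K (t i) (e i)].

Variables (k1 k2 : C).

Definition TQ_solution (t q : {poly C}) : Prop :=
  [/\ (size q <= (\sum_(n < N) m n).+1)%N,
      forall n, q.[xish n (m n)] != 0 &
      forall la, t.[la] * q.[la] =
        k1 * afun la * q.[la - eta] + k2 * dfun la * q.[la + eta]].

(* Q is the Q-operator normalized at zeta; Qt maps the eigenvalue t to the
   polynomial Q_t.  The normalization forces zeta to avoid the roots of the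
   Q_t, which is the genericity of zeta. *)
Definition is_Q_operator (K : 'M[C]_2) (zeta : C)
    (Qt : {poly C} -> {poly C}) (Q : C -> 'M[C]_qdim) : Prop :=
  exists t : label -> {poly C}, exists e : label -> 'cV[C]_qdim,
    transfer_eigenbasis K t e /\
    forall i, [/\ TQ_solution (t i) (Qt (t i)),
                  (Qt (t i)).[zeta] = 1 &
                  forall la, Q la *m e i = (Qt (t i)).[la] *: e i].

Definition is_SoV_basis (K : 'M[C]_2) (Qt : {poly C} -> {poly C})
    (cov : label -> 'rV[C]_qdim) : Prop :=
  basis_of fullv (codom cov) /\
  forall t v, transfer_eigenvector K t v ->
    exists2 c : C, c != 0 &
      forall h, (cov h *m (c *: v)) 0 0 = \prod_(n < N) (Qt t).[xish n (h n)].

(* <L| prod_n Q(xi_n^(h_n)) *)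
Definition Q_covector (Q : C -> 'M[C]_qdim) (L : 'rV[C]_qdim) (h : label) :
    'rV[C]_qdim :=
  L *m \prod_(n < N) Q (xish n (h n)).

Definition fused_covector (K : 'M[C]_2) (S : 'rV[C]_qdim) (h : label) :
    'rV[C]_qdim :=
  S *m \prod_(n < N)
    ((k2 ^ ((h n)%:Z - (m n)%:Z) /
        \prod_(k < m n - h n) dfun (xish n (m n - k)))
     *: fused_transfer K (m n - h n) (xish n (m n))).

Definition Sklyanin_covector (K : 'M[C]_2) (h : label) : 'rV[C]_qdim :=
  covac *m \prod_(n < N) \prod_(k < h n)
    ((k1 * afun (xish n k))^-1 *: opA K (xish n k)).

(* For K_12 = 0: W is the change of basis with W^-1 K W off-diagonal entries
   both nonzero. *)
Definition Sklyanin_covector_gauged (K W : 'M[C]_2) (h : label) :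
    'rV[C]_qdim :=
  Sklyanin_covector (invmx W *m K *m W) h *m invmx (gauge W).

End Chain.

Arguments xish {C N} m eta xi n k.
Arguments is_Q_operator {C N} m eta xi k1 k2 K zeta Qt Q.
Arguments is_SoV_basis {C N} m eta xi K Qt cov.
Arguments Q_covector {C N} m eta xi Q L h.
Arguments fused_covector {C N} m eta xi k2 K S h.
Arguments Sklyanin_covector {C N} m eta xi k1 K h.
Arguments Sklyanin_covector_gauged {C N} m eta xi k1 K W h.

(* Main.v *)
(* Sklyanin's covectors <h| = <0| prod A(xi_n^(k)) are eigencovectors of the
   twisted B operator: the RTT relation moves B(la) through A(mu) when <h| is
   killed by B(mu), turning the zero mu = xi_n^(h_n) into xi_n^(h_n + 1).  For
   generic xi the eigenvalues K_12 prod_n (la - xi_n^(h_n)) are pairwise distinct,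
   and no <h| vanishes because the quantum determinant gives
   <h + e_n| D(xi_n^(h_n + 1)) = k_2 d(xi_n^(h_n + 1)) <h|; hence the <h| form a
   basis.  By T = A + D, the numbers <h|t> satisfy the discretised TQ equation in
   each h_n.  As d(xi_n^(0)) = 0, that recursion determines them from <0|t>, so
   <h|t> is proportional to prod_n Q_t(xi_n^(h_n)).  When K_12 = 0 one conjugates
   by W (x) gauge W, which commutes with the Lax operators.

   In particular the matrix of the prod_n Q_t(xi_n^(h_n)), indexed by the
   eigenvalues t and the labels h, is invertible, so <L| prod_n Q(xi_n^(h_n)) is a
   basis as soon as <L| has a nonzero pairing with every eigenvector.

   For the fused transfer matrices, T^(l)(la) = sum_k S_kk where S_kj is the sum of
   the coefficients M_{f,g} over the words f of weight k, for any word g of weight j: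
   by RTT it depends on g only through j.  Expanding S_kk along a first letter
   chosen at will in g gives
   T^(l+1)(la) = T(la + l eta) T^(l)(la) - qdet(la + (l-1) eta) T^(l-1)(la),
   which at la = xi_n^(2 s_n) is again solved by the TQ equation. *)

Require Import Defs.
From mathcomp Require Import all_boot all_order all_algebra perm reals complex.
From mathcomp.multinomials Require Import mpoly.
From mathcomp Require Import ring zify.

Set Implicit Arguments.
Unset Strict Implicit.
Unset Printing Implicit Defensive.

Import GRing.Theory Num.Theory.
Local Open Scope ring_scope.

(** * Operators on the tensor product of the sites *)

(** Distributivity when the index type of each sum depends on the factor. [big_fprod] passes to
    plain functions into the tagged union, where the non-dependent law applies. *)
Lemma bigA_distr_dffun (R : comPzRingType) (I : finType) (T : I -> finType)
    (F : forall i, T i -> R) :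
  \prod_i \sum_(x : T i) F i x =
  \sum_(f : {dffun forall i, T i}) \prod_i F i (f i).
Proof.
rewrite (reindex (@dffun_of_fprod I T)); last exact/onW_bij/dffun_of_fprod_bij.
have -> : \sum_j \prod_i F i (dffun_of_fprod j i) =
    \sum_(t : fprod T) \prod_(i in I) [ffun x : T i => F i x] (t i).
  by apply: eq_bigr => t _; apply: eq_bigr => i _; rewrite !ffunE.
rewrite big_fprod -(bigA_distr_big_dep _
  (fun i => untag 0 [ffun x : T i => F i x])); apply: eq_bigr => i _.
rewrite -(big_tag (fun j => [ffun x : T j => F j x])).
by apply: eq_bigr => x _; rewrite ffunE.
Qed.

Section Tensor.
Variables (C : numClosedFieldType) (N : nat) (m : 'I_N -> nat).
Local Notation label := (label m).
Local Notation q := (qdim m).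
Implicit Types (A B : forall n : 'I_N, 'M[C]_((m n).+1)).
Implicit Types (u : forall n : 'I_N, 'rV[C]_((m n).+1)).

Lemma sum_enum_val (F : label -> C) : \sum_(k < q) F (enum_val k) = \sum_l F l.
Proof.
rewrite [RHS](reindex (@enum_val _ (pred_of_simpl (pred_of_argType label)))) //=.
exact/onW_bij/enum_val_bij.
Qed.

Lemma tens_mxM A B :
  tens_mx A *m tens_mx B = tens_mx (fun n => A n *m B n).
Proof.
apply/matrixP => i j; rewrite !mxE.
under [RHS]eq_bigr do rewrite mxE.
rewrite bigA_distr_dffun -sum_enum_val; apply: eq_bigr => k _.
by rewrite !mxE -big_split.
Qed.

Lemma tens_rowM u A :
  tens_row u *m tens_mx A = tens_row (fun n => u n *m A n).
Proof.
apply/matrixP => i j; rewrite !mxE.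
under [RHS]eq_bigr do rewrite mxE.
rewrite bigA_distr_dffun -sum_enum_val; apply: eq_bigr => k _.
by rewrite !mxE -big_split.
Qed.

Lemma eq_tens_mx A B : (forall n, A n = B n) -> tens_mx A = tens_mx B.
Proof.
by move=> AB; apply/matrixP => i j; rewrite !mxE; apply: eq_bigr => n _; rewrite AB.
Qed.

Lemma tens_mx1 : tens_mx (fun n => 1%:M : 'M[C]_((m n).+1)) = 1%:M.
Proof.
apply/matrixP => i j; rewrite !mxE.
have [-> | ij] := eqVneq i j.
  by rewrite big1 // => n _; rewrite mxE eqxx.
have [n nij] : exists n, (enum_val i : label) n != (enum_val j : label) n.
  apply/existsP; apply: contraNT ij; rewrite negb_exists => /forallP ij.
  apply/eqP/enum_val_inj/ffunP => n.
  by apply/eqP; move: (ij n); rewrite negbK.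
by rewrite (bigD1 n) //= mxE (negPf nij) mul0r.
Qed.

(** Isolates the one factor containing [X], which makes [site] visibly linear. *)
Lemma site_entry n (X : 'M[C]_((m n).+1)) (i j : 'I_q) :
  site X i j = X ((enum_val i : label) n) ((enum_val j : label) n) *
   \prod_(p < N | p != n) (((enum_val i : label) p) == ((enum_val j : label) p))%:R.
Proof.
rewrite mxE (bigD1 n) //= dfwith_in; congr (_ * _).
by apply: eq_bigr => p; rewrite eq_sym => np; rewrite dfwith_out // mxE.
Qed.

Lemma siteM n (X Y : 'M[C]_((m n).+1)) : site X *m site Y = site (X *m Y).
Proof.
rewrite tens_mxM; apply: eq_tens_mx => p.
have [<- | np] := eqVneq n p; first by rewrite !dfwith_in.
by rewrite !dfwith_out // mulmx1.
Qed.

Lemma site1 n : site (1%:M : 'M[C]_((m n).+1)) = 1%:M.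
Proof.
rewrite -tens_mx1; apply: eq_tens_mx => p.
have [<- | np] := eqVneq n p; first by rewrite !dfwith_in.
by rewrite !dfwith_out.
Qed.

Lemma siteD n (X Y : 'M[C]_((m n).+1)) : site (X + Y) = site X + site Y.
Proof.
by apply/matrixP => i j; rewrite [RHS]mxE !site_entry mxE mulrDl.
Qed.

Lemma siteZ n a (X : 'M[C]_((m n).+1)) : site (a *: X) = a *: site X.
Proof.
by apply/matrixP => i j; rewrite [RHS]mxE !site_entry mxE mulrA.
Qed.

Lemma site_comm n p (X : 'M[C]_((m n).+1)) (Y : 'M[C]_((m p).+1)) : n != p ->
  site X *m site Y = site Y *m site X.
Proof.
move=> np; rewrite !tens_mxM; apply: eq_tens_mx => r.
have [nr | nr] := eqVneq n r.
  have pr : p != r by rewrite -nr eq_sym.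
  by rewrite !(dfwith_out _ Y pr) mulmx1 mul1mx.
by rewrite !(dfwith_out _ X nr) mulmx1 mul1mx.
Qed.

Lemma covac_site n (X : 'M[C]_((m n).+1)) c :
  delta_mx 0 0 *m X = c *: (delta_mx 0 0 : 'rV_((m n).+1)) ->
  covac C m *m site X = c *: covac C m.
Proof.
move=> Xc; rewrite tens_rowM.
apply/matrixP => i j; rewrite !mxE !(bigD1 n (P := predT)) //= mulrA.
congr (_ * _).
  by rewrite dfwith_in Xc !mxE.
by apply: eq_bigr => p; rewrite eq_sym => np; rewrite dfwith_out // mulmx1.
Qed.

Lemma gauge_site n (W : 'M[C]_2) (X Y : 'M[C]_((m n).+1)) :
  sym_pow (m n) W *m X = Y *m sym_pow (m n) W ->
  gauge m W *m site X = site Y *m gauge m W.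
Proof.
move=> XY; rewrite !tens_mxM; apply: eq_tens_mx => p.
have [<- | np] := eqVneq n p; first by rewrite !dfwith_in.
by rewrite !dfwith_out // mulmx1 mul1mx.
Qed.

Lemma covac_neq0 : covac C m != 0.
Proof.
apply/negP => /eqP/rowP /(_ (enum_rank (finfun (fun n => ord0) : label))).
rewrite !mxE enum_rankK => /eqP; rewrite big1 ?oner_eq0 // => n _.
by rewrite ffunE mxE !eqxx.
Qed.

End Tensor.

(** * Spin matrices *)

Section Spin.
Variables (C : numClosedFieldType) (m : nat).
Local Notation Sz := (Sz C m).
Local Notation Sp := (Splus C m).
Local Notation Sm := (Sminus C m).

Lemma SzSp : Sz *m Sp - Sp *m Sz = Sp.
Proof.
apply/matrixP => i j; rewrite mul_diag_mx mul_mx_diag !mxE.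
case: eqP => [-> | _]; last by rewrite !(mulr0, mul0r) subr0.
rewrite -[i.+1]addn1 natrD; ring.
Qed.

Lemma SzSm : Sz *m Sm - Sm *m Sz = - Sm.
Proof.
apply: trmx_inj; rewrite linearB linearN /= !trmx_mul trmxK tr_diag_mx.
by rewrite -[in RHS]SzSp opprB.
Qed.

Lemma SpSm : Sp *m Sm = diag_mx (\row_(i < m.+1) (i.+1 * (m - i))%:R).
Proof.
apply/matrixP => i j; rewrite !mxE.
have [<- | ij] := eqVneq i j; last first.
  rewrite big1 // => k _; rewrite !mxE.
  case: eqP => [ki | _]; last by rewrite mul0r.
  case: eqP => [kj | _]; last by rewrite mulr0.
  by case/eqP: ij; apply/val_inj; move: ki; rewrite kj => -[].
rewrite mulr1n; have [im | mi] := ltnP i m; last first.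
  rewrite (eqP mi) muln0 big1 // => k _; rewrite !mxE.
  case: eqP => [ki | _]; last by rewrite mul0r.
  by have := ltn_ord k; rewrite ki !ltnS leqNgt ltnS mi.
rewrite (bigD1 (Ordinal (im : (i.+1 < m.+1)%N))) //= !mxE eqxx -expr2 sqrtCK.
rewrite big1 ?addr0 // => k nk; rewrite !mxE.
case: eqP => [ki | _]; last by rewrite mul0r.
by case/eqP: nk; apply/val_inj.
Qed.

Lemma SmSp : Sm *m Sp = diag_mx (\row_(i < m.+1) (i * (m - i.-1))%:R).
Proof.
apply/matrixP => i j; rewrite !mxE.
have [<- | ij] := eqVneq i j; last first.
  rewrite big1 // => k _; rewrite !mxE.
  case: eqP => [ki | _]; last by rewrite mul0r.
  case: eqP => [kj | _]; last by rewrite mulr0.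
  by case/eqP: ij; apply/val_inj; rewrite /= ki kj.
rewrite mulr1n; case: i => -[|i] im.
  by rewrite mul0n big1 // => k _; rewrite !mxE mul0r.
rewrite (bigD1 (Ordinal (ltnW im : (i < m.+1)%N))) //= !mxE eqxx -expr2 sqrtCK.
rewrite big1 ?addr0 // => k nk; rewrite !mxE.
case: eqP => [ki | _]; last by rewrite mul0r.
by case/eqP: nk; apply/val_inj; case: ki.
Qed.

Lemma SpSmB : Sp *m Sm - Sm *m Sp = 2 *: Sz.
Proof.
rewrite SpSm SmSp -linearB -linearZ /=; congr diag_mx.
apply/rowP => i; rewrite !mxE.
have im : (i <= m)%N by rewrite -ltnS.
rewrite !natrM (natrB _ im); case: i im => -[|i] /= _ im.
  by rewrite mul0r -[1%:R]/1; field.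
by rewrite natrB 1?ltnW // -![i.+1]addn1 -[(i + 1).+1]addn1 !natrD; field.
Qed.

(** The Casimir identity $S^2=s(s+1)$, $s=m/2$, with $S^-S^+$ eliminated through the commutator. It
    makes the quantum determinant of a Lax operator scalar. *)
Lemma casimir : Sz *m Sz + Sp *m Sm = (m%:R / 2 * (m%:R / 2 + 1))%:M + Sz.
Proof.
rewrite SpSm mulmx_diag -linearD /= -diag_const_mx -linearD /=; congr diag_mx.
apply/rowP => i; rewrite !mxE.
have im : (i <= m)%N by rewrite -ltnS.
by rewrite !natrM (natrB _ im) -[i.+1]addn1 natrD; field.
Qed.

(* On symmetric tensors the (i, j) entry acts as sum_k E_ji^(k) - m/2 delta_ij. *)
Definition spin_mx : 'M['M[C]_m.+1]_2 :=
  \matrix_(i < 2, j < 2) if i == 0 then (if j == 0 then Sz else Sm)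
                         else (if j == 0 then Sp else - Sz).

(** The $\mathfrak{gl}_2$ relations of the matrix units $E_{ji}$, hence the transposed indices; the
    scalar shifts drop out of the commutator and cancel on the right. *)
Lemma spin_mx_comm i j k l :
  spin_mx i j *m spin_mx k l - spin_mx k l *m spin_mx i j =
  (i == l)%:R *: spin_mx k j - (k == j)%:R *: spin_mx i l.
Proof.
have ord2 (x : 'I_2) : (x = 0) \/ (x = 1).
  by case: x => -[|[|//]] ?; [left | right]; apply/val_inj.
have E00 : spin_mx 0 0 = Sz by rewrite mxE.
have E01 : spin_mx 0 1 = Sm by rewrite mxE.
have E10 : spin_mx 1 0 = Sp by rewrite mxE.
have E11 : spin_mx 1 1 = - Sz by rewrite mxE.
have D2 (X : 'M[C]_m.+1) : X + X = 2 *: X by rewrite scaler_nat mulr2n.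
have NN (X Y : 'M[C]_m.+1) : X - Y = - (Y - X) by rewrite opprB.
case: (ord2 i) => ->; case: (ord2 j) => ->;
  case: (ord2 k) => ->; case: (ord2 l) => ->;
  rewrite ?(E00, E01, E10, E11) /= ?(mulmxN, mulNmx) ?opprK ?(scale1r, scale0r)
    ?subrr ?subr0 ?sub0r ?opprK ?D2 //.
all: rewrite ?(SzSp, SzSm, SpSmB) //.
all: try by rewrite NN ?(SzSp, SzSm, SpSmB) ?opprK // -?D2 ?opprD.
all: try by rewrite addrC ?(SzSp, SzSm, SpSmB) ?opprK // -?D2 ?opprD.
all: try by rewrite addrC NN ?(SzSp, SzSm, SpSmB) ?opprK // -?D2 ?opprD.
all: by rewrite addNr.
Qed.

End Spin.

(** * The RTT relation and the quantum determinant *)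

Lemma sum2E (V : nmodType) (F : 'I_2 -> V) : \sum_a F a = F 0 + F 1.
Proof. by rewrite big_ord_recl big_ord1; congr (_ + F _); apply/val_inj. Qed.

Lemma ord2P (x : 'I_2) : x = 0 \/ x = 1.
Proof. by case: x => -[|[|//]] ?; [left | right]; apply/val_inj. Qed.

Section RTT.
Variables (C : numClosedFieldType) (eta : C).
Hypothesis eta0 : eta != 0.

(** Entries of $R(\lambda-\mu)M_1(\lambda)M_2(\mu)=M_2(\mu)M_1(\lambda)R(\lambda-\mu)$ for the
    rational R-matrix $R(u)=u+\eta P$, where $P$ is the flip. *)
Definition RTT q (M : C -> 'M['M[C]_q]_2) : Prop := forall la mu i j k l,
  (la - mu) *: (M la i j *m M mu k l) + eta *: (M la k j *m M mu i l) =
  (la - mu) *: (M mu k l *m M la i j) + eta *: (M mu k j *m M la i l).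

Definition qdet q (M : C -> 'M['M[C]_q]_2) (u : C) : 'M[C]_q :=
  M (u + eta) 1 1 *m M u 0 0 - M (u + eta) 1 0 *m M u 0 1.

Lemma mx2M q (X Y : 'M['M[C]_q]_2) i j : (X * Y) i j = \sum_a X i a *m Y a j.
Proof. by rewrite mxE. Qed.

Lemma RTT_const q (K : 'M[C]_2) :
  RTT (fun _ => map_mx (fun c : C => c%:M : 'M[C]_q) K).
Proof.
move=> la mu i j k l; rewrite !mxE -!scalar_mxM.
by rewrite [K i j * _]mulrC.
Qed.

Lemma RTT_shift q (M : C -> 'M['M[C]_q]_2) c : RTT M -> RTT (fun la => M (la - c)).
Proof.
move=> RM la mu i j k l.
have := RM (la - c) (mu - c) i j k l.
by rewrite (_ : la - c - (mu - c) = la - mu) //; ring.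
Qed.

(** The R-matrix is moved past [M] and then past [M']; commutation of their entries allows the
    products to be regrouped for each step. *)
Lemma RTT_mul q (M M' : C -> 'M['M[C]_q]_2) : RTT M -> RTT M' ->
  (forall la mu i j k l, M la i j *m M' mu k l = M' mu k l *m M la i j) ->
  RTT (fun la => M la * M' la).
Proof.
move=> RM RM' MM' la mu i j k l.
have E la1 la2 i1 j1 i2 j2 :
    (M la1 * M' la1) i1 j1 *m (M la2 * M' la2) i2 j2 =
    \sum_a \sum_b (M la1 i1 a *m M la2 i2 b) *m (M' la1 a j1 *m M' la2 b j2).
  rewrite !mx2M mulmx_suml; apply: eq_bigr => a _.
  rewrite mulmx_sumr; apply: eq_bigr => b _.
  by rewrite !mulmxA; congr (_ *m _); rewrite -!mulmxA MM'.
rewrite !E.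
transitivity (\sum_a \sum_b ((la - mu) *: (M mu k b *m M la i a) +
    eta *: (M mu k a *m M la i b)) *m (M' la a j *m M' mu b l)).
  rewrite !scaler_sumr -big_split; apply: eq_bigr => a _ /=.
  rewrite !scaler_sumr -big_split; apply: eq_bigr => b _ /=.
  by rewrite -RM mulmxDl -!scalemxAl.
transitivity (\sum_a \sum_b (M mu k b *m M la i a) *m
    ((la - mu) *: (M' la a j *m M' mu b l) + eta *: (M' la b j *m M' mu a l))).
  under eq_bigr do under eq_bigr do rewrite mulmxDl.
  under [RHS]eq_bigr do under eq_bigr do rewrite mulmxDr.
  under eq_bigr do rewrite big_split; under [RHS]eq_bigr do rewrite big_split.
  rewrite /= !big_split /= [X in _ + X]exchange_big /=.
  by congr (_ + _); apply: eq_bigr => a _; apply: eq_bigr => b _;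
    rewrite -scalemxAl -scalemxAr.
rewrite exchange_big !scaler_sumr -big_split /=; apply: eq_bigr => b _.
rewrite !scaler_sumr -big_split; apply: eq_bigr => a _ /=.
by rewrite RM' mulmxDr -!scalemxAr.
Qed.

(** At $\lambda-\mu=-\eta$ the R-matrix is $\eta(P-1)$, proportional to an antisymmetriser. The
    properties of the quantum determinant are instances of this degenerate relation. *)
Lemma RTT_qdet_gen q (M : C -> 'M['M[C]_q]_2) (u : C) i j k l : RTT M ->
  M (u + eta) k l *m M u i j - M (u + eta) k j *m M u i l =
  M u i j *m M (u + eta) k l - M u k j *m M (u + eta) i l.
Proof.
move=> RM; have eta0' : - eta != 0 by rewrite oppr_eq0.
apply: (scalerI eta0'); have := RM u (u + eta) i j k l.
rewrite (_ : u - (u + eta) = - eta); last by ring.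
by rewrite !scalerBr !scaleNr !opprK => ->.
Qed.

Lemma qdetE q (M : C -> 'M['M[C]_q]_2) (u : C) : RTT M ->
  qdet M u = M (u + eta) 0 0 *m M u 1 1 - M (u + eta) 0 1 *m M u 1 0.
Proof.
move=> RM; rewrite (RTT_qdet_gen u 1 1 0 0 RM) /qdet.
apply: oppr_inj; rewrite !opprB.
by rewrite (RTT_qdet_gen u 0 1 1 0 RM).
Qed.

(** With equal row indices the right-hand side of the degenerate relation vanishes. *)
Lemma RTT_same_row q (M : C -> 'M['M[C]_q]_2) (u : C) k l j : RTT M ->
  M (u + eta) k l *m M u k j = M (u + eta) k j *m M u k l.
Proof.
by move=> RM; apply/eqP; rewrite -subr_eq0 RTT_qdet_gen // subrr.
Qed.

(** Summing over the intermediate indices, the terms with equal indices cancel by the same-row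
    relation; the other two contain both expansions of [qdet M'], with opposite signs. *)
Lemma qdet_mul q (M M' : C -> 'M['M[C]_q]_2) u : RTT M -> RTT M' ->
  (forall la mu i j k l, M la i j *m M' mu k l = M' mu k l *m M la i j) ->
  qdet (fun la => M la * M' la) u = qdet M u *m qdet M' u.
Proof.
move=> RM RM' MM'.
have E la1 la2 i1 j1 i2 j2 :
    (M la1 * M' la1) i1 j1 *m (M la2 * M' la2) i2 j2 =
    \sum_a \sum_b (M la1 i1 a *m M la2 i2 b) *m (M' la1 a j1 *m M' la2 b j2).
  rewrite !mx2M mulmx_suml; apply: eq_bigr => a _.
  rewrite mulmx_sumr; apply: eq_bigr => b _.
  by rewrite !mulmxA; congr (_ *m _); rewrite -!mulmxA MM'.
rewrite {1}/qdet !E -sumrB; under eq_bigr do rewrite -sumrB; rewrite !sum2E.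
rewrite -!mulmxBr (RTT_same_row _ _ _ _ RM') subrr mulmx0 add0r.
rewrite [X in _ + (_ + X)](_ : _ = 0) ?addr0; last first.
  by rewrite (RTT_same_row _ _ _ _ RM') subrr mulmx0.
rewrite -[X in _ *m X]opprB -(qdetE _ RM') mulmxN addrC {2}/qdet mulmxBl.
by [].
Qed.

(** For equal entries RTT is $(\lambda-\mu+\eta)$ times the commutator. If that factor vanishes,
    exchanging $\lambda$ and $\mu$ replaces it by $2\eta\neq0$. *)
Lemma RTT_comm q (M : C -> 'M['M[C]_q]_2) la mu i j : RTT M ->
  M la i j *m M mu i j = M mu i j *m M la i j.
Proof.
move=> RM.
have H x y : x - y + eta != 0 -> M x i j *m M y i j = M y i j *m M x i j.
  by move=> xy; apply: (scalerI xy); rewrite ![(_ - _ + _) *: _]scalerDl; apply: RM.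
have [e|] := eqVneq (la - mu + eta) 0; last exact: H.
apply/esym/H; rewrite (_ : mu - la + eta = - (la - mu + eta) + 2 * eta); last by ring.
by rewrite e oppr0 add0r mulf_neq0 // pnatr_eq0.
Qed.

Lemma RTT_AB q (M : C -> 'M['M[C]_q]_2) (w : 'rV[C]_q) la mu b : RTT M -> la != mu ->
  w *m M la 0 1 = b *: w -> w *m M mu 0 1 = 0 ->
  w *m M mu 0 0 *m M la 0 1 =
  (b * (la - mu + eta) / (la - mu)) *: (w *m M mu 0 0).
Proof.
move=> RM lm wb w0; have lm0 : la - mu != 0 by rewrite subr_eq0.
have := congr1 (mulmx w) (RM la mu 0 1 0 0).
rewrite !mulmxDr -!scalemxAr !mulmxA w0 mul0mx scaler0 addr0 -scalerDl wb.
rewrite -scalemxAl scalerA => H; apply: (scalerI lm0); rewrite -H scalerA.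
by congr (_ *: _); field.
Qed.

(** Carries the vanishing of $w\mathsf D(\lambda)$ through a further $\mathsf A(\mu)$: both
    exchanged terms begin with a $\mathsf B$ that kills [w]. *)
Lemma RTT_AD q (M : C -> 'M['M[C]_q]_2) (w : 'rV[C]_q) la mu : RTT M -> la != mu ->
  w *m M la 0 1 = 0 -> w *m M mu 0 1 = 0 -> w *m M la 1 1 = 0 ->
  w *m M mu 0 0 *m M la 1 1 = 0.
Proof.
move=> RM lm wl wm wD; have lm0 : la - mu != 0 by rewrite subr_eq0.
have := congr1 (mulmx w) (RM la mu 1 1 0 0).
rewrite !mulmxDr -!scalemxAr !mulmxA wl wm wD !mul0mx !scaler0 !addr0.
by move=> H; apply: (scalerI lm0); rewrite -H scaler0.
Qed.

Lemma qdet_row q (M : C -> 'M['M[C]_q]_2) (w : 'rV[C]_q) u : RTT M ->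
  w *m M (u + eta) 0 1 = 0 ->
  w *m M (u + eta) 0 0 *m M u 1 1 = w *m qdet M u.
Proof.
move=> RM w0; rewrite (qdetE u RM) mulmxBr.
by rewrite [w *m (M (u + eta) 0 1 *m _)]mulmxA w0 mul0mx subr0 mulmxA.
Qed.

End RTT.

(** * Products of Lax operators and their action on the vacuum covector *)

Section Chain.
Variables (C : numClosedFieldType) (eta : C) (eta0 : eta != 0).
Variables (N : nat) (m : 'I_N -> nat) (xi : 'I_N -> C).
Local Notation q := (qdim m).
Local Notation Lax := (Lax m eta).
Local Notation xish := (xish m eta xi).
Local Notation afun := (afun m eta xi).
Local Notation dfun := (dfun m eta xi).
Local Notation monodromy := (monodromy m eta xi).

Lemma LaxE n la i j : Lax n la i j =
  ((i == j)%:R * (la + eta / 2)) *: 1%:M + eta *: site (spin_mx C (m n) i j).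
Proof.
rewrite -siteZ -(site1 C m n) -siteZ -siteD !mxE scalemx1.
case: (ord2P i) => ->; case: (ord2P j) => -> /=;
  by rewrite ?mul1r ?mul0r ?raddf0 ?add0r ?scalerN.
Qed.

Lemma site_spin_comm n i j k l :
  site (spin_mx C (m n) i j) *m site (spin_mx C (m n) k l) =
  site (spin_mx C (m n) k l) *m site (spin_mx C (m n) i j) +
  ((i == l)%:R *: site (spin_mx C (m n) k j) +
   (- (k == j)%:R) *: site (spin_mx C (m n) i l)).
Proof.
by rewrite !siteM -!siteZ -!siteD scaleNr -spin_mx_comm addrC subrK.
Qed.

Lemma RTT_Lax n : RTT eta (Lax n).
Proof.
move=> la mu i j k l; rewrite !LaxE.
rewrite !(mulmxDl, mulmxDr) -?(scalemxAl, scalemxAr) ?(mulmx1, mul1mx).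
(* The products with exchanged indices agree on both sides, so a single commutator is enough. *)
rewrite (site_spin_comm n i j k l).
move: (site (spin_mx C (m n) i j)) (site (spin_mx C (m n) k l))
  (site (spin_mx C (m n) k j)) (site (spin_mx C (m n) i l)) => s1 s2 s3 s4.
move: (s2 *m s1) (s3 *m s4) => p1 p2.
by apply/matrixP => a b; rewrite !mxE; ring.
Qed.

Lemma qdet_Lax n la : qdet eta (Lax n) la =
  ((la + eta + eta / 2 + (m n)%:R / 2 * eta) * (la + eta / 2 - (m n)%:R / 2 * eta))%:M.
Proof.
have cas : site (Splus C (m n)) *m site (Sminus C (m n)) =
    ((m n)%:R / 2 * ((m n)%:R / 2 + 1)) *: 1%:M + site (Sz C (m n)) +
    (-1) *: (site (Sz C (m n)) *m site (Sz C (m n))).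
  rewrite -(site1 C m n) !siteM -!siteZ -!siteD scalemx1 -casimir scaleN1r.
  by rewrite [_ *m _ + _]addrC addrK.
have s11 : site (- Sz C (m n)) = (-1) *: site (Sz C (m n)).
  by rewrite -siteZ scaleN1r.
rewrite /qdet !LaxE /= [spin_mx _ _ 0 0]mxE [spin_mx _ _ 0 1]mxE [spin_mx _ _ 1 0]mxE
  [spin_mx _ _ 1 1]mxE /= s11.
rewrite !(mulmxDl, mulmxDr) -?(scalemxAl, scalemxAr) ?(mulmx1, mul1mx) cas.
move: (site (Sz C (m n))) (site (Splus C (m n))) (site (Sminus C (m n))) => z p mm.
rewrite -[in RHS]scalemx1.
by move: (z *m z) => zz; apply/matrixP => a b; rewrite !mxE; field.
Qed.

(** Taken along an arbitrary list of sites, so that properties of the monodromy follow by induction,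
    one site at a time. *)
Definition chain r (la : C) : 'M['M[C]_q]_2 := \prod_(n <- r) Lax n (la - xi n).

Lemma chain_cons n r la : chain (n :: r) la = Lax n (la - xi n) * chain r la.
Proof. exact: big_cons. Qed.

Lemma chain_nil la : chain [::] la = 1.
Proof. exact: big_nil. Qed.

Lemma one2E i j : (1 : 'M['M[C]_q]_2) i j = (i == j)%:R *: 1%:M.
Proof. by rewrite !mxE; case: eqP; rewrite ?scale1r ?scale0r. Qed.

Lemma site_chain n (X : 'M[C]_((m n).+1)) r la i j : n \notin r ->
  site X *m chain r la i j = chain r la i j *m site X.
Proof.
elim: r i j => [|p r IH] i j.
  by rewrite chain_nil one2E -scalemxAl -scalemxAr mul1mx mulmx1.
rewrite inE negb_or => /andP[np nr]; rewrite chain_cons mx2M.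
rewrite mulmx_sumr mulmx_suml; apply: eq_bigr => a _.
rewrite -mulmxA -IH // !mulmxA; congr (_ *m _).
rewrite LaxE mulmxDl mulmxDr -!scalemxAl -!scalemxAr mulmx1 mul1mx.
by rewrite (site_comm X) .
Qed.

Lemma Lax_chain n r la mu i j k l : n \notin r ->
  Lax n la i j *m chain r mu k l = chain r mu k l *m Lax n la i j.
Proof.
move=> nr; rewrite LaxE mulmxDl mulmxDr -!scalemxAl -!scalemxAr.
by rewrite mulmx1 mul1mx site_chain.
Qed.

Lemma RTT_chain r : uniq r -> RTT eta (chain r).
Proof.
elim: r => [_ | n r IH /andP[nr ur]] la mu i j k l.
  rewrite !chain_nil !one2E -!(scalemxAl, scalemxAr) !scalerA mulmx1.
  by rewrite [_ * (k == l)%:R]mulrAC.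
rewrite !chain_cons; apply: (RTT_mul (M := fun la => Lax n (la - xi n))).
- exact: (RTT_shift _ (RTT_Lax n)).
- exact: IH.
by move=> *; apply: Lax_chain.
Qed.

Lemma xish0 n : xish n 0 = xi n - eta / 2 + (m n)%:R / 2 * eta.
Proof. by rewrite /Defs.xish subr0. Qed.

Lemma xish_max n : xish n (m n) = xi n - eta / 2 - (m n)%:R / 2 * eta.
Proof. by rewrite /Defs.xish; field. Qed.

Lemma xishB n j k : (j <= k)%N -> xish n j = xish n k + (k - j)%:R * eta.
Proof. by move=> jk; rewrite /Defs.xish natrB //; ring. Qed.

Lemma xishS n k : xish n k.+1 = xish n k - eta.
Proof. by rewrite (xishB n (leqnSn k)) subSnn mul1r addrK. Qed.

Lemma qdet_chain r u : uniq r -> qdet eta (chain r) u =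
  (\prod_(n <- r) ((u + eta - xish n (m n)) * (u - xish n 0)))%:M.
Proof.
elim: r => [_ | n r IH /andP[nr ur]].
  by rewrite /qdet !chain_nil !one2E big_nil /= !scale1r !scale0r mul0mx subr0 mulmx1.
rewrite big_cons scalar_mxM -(IH ur).
transitivity (qdet eta (fun la => Lax n (la - xi n)) u *m qdet eta (chain r) u).
  rewrite -(qdet_mul eta0).
  - by rewrite /qdet !chain_cons.
  - exact: (RTT_shift _ (RTT_Lax n)).
  - exact: RTT_chain.
  by move=> *; apply: Lax_chain.
congr (_ *m _).
have -> : qdet eta (fun la => Lax n (la - xi n)) u = qdet eta (Lax n) (u - xi n).
  by rewrite /qdet (_ : u + eta - xi n = (u - xi n) + eta); last by ring.
rewrite qdet_Lax xish0 xish_max.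
by congr (_ %:M); ring.
Qed.

Lemma covac_Sm n : covac C m *m site (Sminus C (m n)) = 0.
Proof.
rewrite (@covac_site C N m n _ 0) ?scale0r //.
by apply/rowP => j; rewrite -rowE !mxE.
Qed.

Lemma covac_Sz n : covac C m *m site (Sz C (m n)) = ((m n)%:R / 2) *: covac C m.
Proof.
apply: covac_site; rewrite mul_mx_diag; apply/rowP => j; rewrite !mxE.
rewrite eqxx /=; case: eqP => [-> | _]; last by rewrite !(mulr0, mul0r).
by rewrite subr0 mulr1 mul1r.
Qed.

(** Since $\langle0|S_n^-=0$, each Lax operator acts triangularly on $\langle0|$, with last diagonal
    entry $\lambda-\xi_n^{(0)}$. Entries at different sites commute, so either factor may be applied
    to $\langle0|$ first. *)
Lemma covac_chain r la : uniq r ->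
  covac C m *m chain r la 0 1 = 0 /\
  covac C m *m chain r la 1 1 = (\prod_(n <- r) (la - xish n 0)) *: covac C m.
Proof.
elim: r => [_ | n r IH /andP[nr ur]].
  by rewrite chain_nil !one2E /= big_nil !scale1r !scale0r mulmx0 mulmx1.
have [IH1 IH2] := IH ur; rewrite chain_cons !mx2M !sum2E big_cons.
rewrite !mulmxDr !Lax_chain // !mulmxA IH1 !mul0mx !add0r.
rewrite -![covac C m *m chain _ _ _ _ *m _]mulmxA -!Lax_chain // !mulmxA !LaxE.
rewrite [spin_mx _ _ 0 1]mxE [spin_mx _ _ 1 1]mxE /= mul0r scale0r add0r.
rewrite -scalemxAr covac_Sm scaler0 mul0mx; split=> //.
rewrite mulmxDr -!scalemxAr mulmx1 -scaleN1r siteZ -scalemxAr covac_Sz.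
rewrite !scalerA -scalerDl -scalemxAl IH2 scalerA; congr (_ *: _).
by rewrite xish0; ring.
Qed.

End Chain.

(** * Sklyanin's covectors *)

(** Serves to pull the last $\mathsf A$ of one site out of the ordered product defining a
    covector. *)
Lemma prod_mulr_comm (R : pzRingType) (I : eqType) (r : seq I) (n : I) (x : R)
    (F G : I -> R) : uniq r -> n \in r -> G n = F n * x ->
  (forall p, p != n -> G p = F p) -> (forall p, GRing.comm x (F p)) ->
  \prod_(p <- r) G p = \prod_(p <- r) F p * x.
Proof.
move=> ur nr Gn GF xF.
have out s : n \notin s -> \prod_(p <- s) G p = \prod_(p <- s) F p.
  by move=> ns; apply: eq_big_seq => p ps; apply: GF; apply: contraNneq ns => <-.
elim: r ur nr => // p r IH /andP[pr ur]; rewrite inE !big_cons.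
have [np _ | np /= nr] := eqVneq n p.
  by rewrite -np Gn out ?np // -!mulrA (commr_prod _ (fun i _ => xF i)).
by rewrite IH // GF 1?eq_sym // mulrA.
Qed.

Lemma eigen_free (F : fieldType) (I : finType) q (B : 'M[F]_q)
    (v : I -> 'rV[F]_q) (a : I -> F) : injective a ->
  (forall i, v i *m B = a i *: v i) -> (forall i, v i != 0) ->
  forall c : I -> F, \sum_i c i *: v i = 0 -> forall i, c i = 0.
Proof.
move=> aI vB v0 c cv i0.
have vP (s : seq I) i : v i *m \big[mulmx/1%:M]_(j <- s) (B - (a j)%:M) =
    (\prod_(j <- s) (a i - a j)) *: v i.
  elim: s => [|j s IH]; first by rewrite !big_nil mulmx1 scale1r.
  rewrite !big_cons mulmxA mulmxBr vB mul_mx_scalar -scalerBl -scalemxAl IH.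
  by rewrite scalerA.
(* The product of the $B-a_j$ over $j\neq i_0$ kills every term except the one at [i0], which it
   multiplies by a nonzero scalar. *)
pose s := [seq j <- enum I | j != i0].
have := congr1 (fun w => w *m \big[mulmx/1%:M]_(j <- s) (B - (a j)%:M)) cv.
rewrite /= mul0mx mulmx_suml (bigD1 i0) //= big1 => [|i ii0]; last first.
  rewrite -scalemxAl vP (big_rem i) /= ?subrr ?mul0r ?scale0r ?scaler0 //.
  by rewrite mem_filter ii0 mem_enum.
rewrite addr0 -scalemxAl vP scalerA => /eqP.
rewrite scaler_eq0 (negPf (v0 i0)) orbF mulf_eq0 => /orP[/eqP //|].
rewrite prodf_seq_eq0 => /hasP[j]; rewrite mem_filter => /andP[ji0 _] /=.
by rewrite subr_eq0 => /eqP/aI ij; rewrite ij eqxx in ji0.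
Qed.

(** * Occupation numbers and induction on them *)

Section Occupation.
Variables (N : nat) (m : 'I_N -> nat).
Implicit Type h : {ffun 'I_N -> nat}.

(** Values are plain naturals, unlike those of [label]: raising one needs no bound, and the bound is
    carried separately. *)
Definition incr h n := [ffun p => if p == n then (h p).+1 else h p].
Definition decr h n := [ffun p => if p == n then (h p).-1 else h p].

Lemma decrK h n : (0 < h n)%N -> incr (decr h n) n = h.
Proof.
move=> hn; apply/ffunP => p; rewrite !ffunE; case: eqP => // ->.
by rewrite prednK.
Qed.

Lemma incr_in h n : incr h n n = (h n).+1.
Proof. by rewrite ffunE eqxx. Qed.

Lemma incr_out h n p : p != n -> incr h n p = h p.
Proof. by rewrite ffunE => /negPf ->. Qed.

Lemma sum_decr h n : (0 < h n)%N -> (\sum_p decr h n p < \sum_p h p)%N.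
Proof.
move=> hn; rewrite [X in (_ < X)%N](bigD1 n) //= (bigD1 n) //= ffunE eqxx.
rewrite (eq_bigr h) => [|p /negPf pn]; last by rewrite ffunE pn.
by rewrite ltn_add2r prednK.
Qed.

Lemma decr_le h n : (forall p, h p <= m p)%N -> forall p, (decr h n p <= m p)%N.
Proof.
move=> hm p; rewrite ffunE; case: eqP => // _; exact: leq_trans (leq_pred _) _.
Qed.

(* Two predecessors are available in the step because the TQ recursion has order two. *)
Lemma occupation_ind (P : {ffun 'I_N -> nat} -> Prop) :
  P [ffun => 0%N] ->
  (forall h n, (forall p, h p <= m p)%N -> (h n < m n)%N -> P h ->
     ((0 < h n)%N -> P (decr h n)) -> P (incr h n)) ->
  forall h, (forall p, h p <= m p)%N -> P h.
Proof.
move=> P0 PS h; have [s] := ubnP (\sum_p h p).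
elim: s h => // s IH h; rewrite ltnS => hs hm.
have [n hn | h0] := pickP (fun n => (0 < h n)%N); last first.
  suff -> : h = [ffun => 0%N] by [].
  by apply/ffunP => n; rewrite ffunE; apply/eqP; rewrite -leqn0 leqNgt h0.
rewrite -(decrK hn); apply: PS.
- exact: decr_le.
- by rewrite ffunE eqxx prednK.
- apply: IH; last exact: decr_le.
  exact: leq_trans (sum_decr hn) hs.
move=> dn; apply: IH; last by do 2 apply: decr_le.
exact: leq_trans (ltn_trans (sum_decr dn) (sum_decr hn)) hs.
Qed.

End Occupation.

Section Sklyanin.
Variables (C : numClosedFieldType) (eta : C) (eta0 : eta != 0).
Variables (N : nat) (m : 'I_N -> nat) (xi : 'I_N -> C).
Local Notation q := (qdim m).
Local Notation label := (label m).
Local Notation Lax := (Lax m eta).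
Local Notation xish := (xish m eta xi).
Local Notation afun := (afun m eta xi).
Local Notation dfun := (dfun m eta xi).

(** * The twisted monodromy matrix *)

Section Monodromy.
Variable K : 'M[C]_2.
Local Notation mon := (monodromy m eta xi K).

Let rs := [seq rev_ord n | n <- index_enum 'I_N].

Lemma uniq_rs : uniq rs.
Proof. by rewrite map_inj_uniq ?index_enum_uniq //; apply: rev_ord_inj. Qed.

Lemma prod_rs (F : 'I_N -> C) : \prod_(n <- rs) F n = \prod_n F n.
Proof. by rewrite big_map [RHS](reindex_inj rev_ord_inj). Qed.

Lemma monE la : mon la =
  map_mx (fun c : C => c%:M : 'M[C]_q) K * chain eta m xi rs la.
Proof. by rewrite /monodromy /chain big_map. Qed.

Lemma RTT_mon : RTT eta mon.
Proof.
move=> la mu i j k l; rewrite !monE.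
apply: (RTT_mul (M := fun _ => map_mx (fun c : C => c%:M : 'M[C]_q) K)).
- exact: RTT_const.
- exact: RTT_chain uniq_rs.
by move=> *; rewrite mxE mul_scalar_mx mul_mx_scalar.
Qed.

Lemma qdet_mon u : qdet eta mon u =
  ((K 1 1 * K 0 0 - K 1 0 * K 0 1) * (afun (u + eta) * dfun u))%:M.
Proof.
rewrite {1}/qdet !monE.
rewrite -[LHS]/(qdet eta (fun u => map_mx (fun c : C => c%:M : 'M[C]_q) K *
  chain eta m xi rs u) u).
rewrite (qdet_mul eta0).
- rewrite qdet_chain ?uniq_rs // big_split !prod_rs scalar_mxM; congr (_ *m _).
  by rewrite /qdet !mxE -!scalar_mxM -raddfB.
- exact: RTT_const.
- exact: RTT_chain uniq_rs.
by move=> *; rewrite mxE mul_scalar_mx mul_mx_scalar.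
Qed.

Lemma covac_monB la : covac C m *m mon la 0 1 = (K 0 1 * dfun la) *: covac C m.
Proof.
have [B0 D0] := covac_chain eta m xi la uniq_rs.
rewrite monE mx2M sum2E !mxE !mul_scalar_mx mulmxDr -!scalemxAr B0 D0.
by rewrite scaler0 add0r scalerA prod_rs.
Qed.

Lemma covac_monD la : covac C m *m mon la 1 1 = (K 1 1 * dfun la) *: covac C m.
Proof.
have [B0 D0] := covac_chain eta m xi la uniq_rs.
rewrite monE mx2M sum2E !mxE !mul_scalar_mx mulmxDr -!scalemxAr B0 D0.
by rewrite scaler0 add0r scalerA prod_rs.
Qed.

Lemma transferE la : transfer m eta xi K la = mon la 0 0 + mon la 1 1.
Proof. by rewrite /transfer /mxtrace sum2E. Qed.

End Monodromy.

(** Concerns distinct sites; on a single site the shifted points differ because $\eta\neq0$. *)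
Definition generic_xi := forall n p k l, n != p -> (k <= m n)%N -> (l <= m p)%N ->
  xish n k != xish p l.

Hypothesis xi_gen : generic_xi.

Lemma xish_inj n : injective (xish n).
Proof.
move=> k l /eqP; rewrite -subr_eq0 /Defs.xish.
rewrite (_ : _ - _ = (l%:R - k%:R) * eta); last by ring.
by rewrite mulf_eq0 (negPf eta0) orbF subr_eq0 eqr_nat => /eqP.
Qed.

Lemma xish_neq n p k l : (k <= m n)%N -> (l <= m p)%N -> (n, k) != (p, l) ->
  xish n k != xish p l.
Proof.
have [-> _ _ | np km lm _] := eqVneq n p; last exact: xi_gen.
by rewrite xpair_eqE eqxx /= => kl; rewrite (inj_eq (@xish_inj p)).
Qed.

Lemma afun_neq0 n k : (k < m n)%N -> afun (xish n k) != 0.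
Proof.
move=> km; apply/prodf_neq0 => p _; rewrite subr_eq0 xish_neq //; first exact: ltnW.
by apply: contraTneq km => -[<- <-]; rewrite ltnn.
Qed.

Lemma afun_max n : afun (xish n (m n)) = 0.
Proof. by rewrite /Defs.afun (bigD1 n) //= subrr mul0r. Qed.

Lemma dfun_neq0 n k : (0 < k <= m n)%N -> dfun (xish n k) != 0.
Proof.
case/andP=> k0 km; apply/prodf_neq0 => p _; rewrite subr_eq0 xish_neq //.
by apply: contraTneq k0 => -[_ ->].
Qed.

Lemma dfun_0 n : dfun (xish n 0) = 0.
Proof. by rewrite /Defs.dfun (bigD1 n) //= subrr mul0r. Qed.

Variables (K : 'M[C]_2) (k1 k2 : C).
Hypotheses (k10 : k1 != 0) (k20 : k2 != 0).
Hypothesis detK : K 1 1 * K 0 0 - K 1 0 * K 0 1 = k1 * k2.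
Local Notation mon := (monodromy m eta xi K).
Local Notation occ := {ffun 'I_N -> nat}.
Implicit Type h : occ.

Definition Sk_vec (h : occ) : 'rV[C]_q :=
  covac C m *m \prod_(n < N) \prod_(k < h n)
    ((k1 * afun (xish n k))^-1 *: opA m eta xi K (xish n k)).

Lemma Sk_vec0 : Sk_vec [ffun => 0%N] = covac C m.
Proof.
rewrite /Sk_vec big1 ?mulmx1 // => n _; rewrite ffunE big_ord0 //.
Qed.

(** The operators $\mathsf A$ commute, so the additional one can be moved to the right end. *)
Lemma Sk_vec_incr h n : Sk_vec (incr h n) =
  (k1 * afun (xish n (h n)))^-1 *: (Sk_vec h *m mon (xish n (h n)) 0 0).
Proof.
rewrite scalemxAr -mulmxA; congr (_ *m _).
apply: (prod_mulr_comm (n := n)); rewrite ?index_enum_uniq ?mem_index_enum //.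
- by rewrite /= incr_in big_ord_recr.
- by move=> p pn /=; rewrite incr_out.
move=> p; apply: commr_prod => k _; rewrite /GRing.comm.
rewrite -!mulmxE -!scalemxAl -!scalemxAr.
by rewrite (RTT_comm eta0 _ _ _ _ (RTT_mon K)) !scalerA mulrC.
Qed.

Lemma Sk_vecA h n : (h n < m n)%N -> Sk_vec h *m mon (xish n (h n)) 0 0 =
  (k1 * afun (xish n (h n))) *: Sk_vec (incr h n).
Proof.
by move=> hn; rewrite Sk_vec_incr scalerA mulfV ?scale1r // mulf_neq0 // afun_neq0.
Qed.

(** The condition on [la] keeps the denominators $\lambda-\mu$ of the exchange relation nonzero
    along the induction. *)
Lemma Sk_vecB h : (forall p, h p <= m p)%N -> forall la,
  (forall n k, (k < h n)%N -> la != xish n k) ->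
  Sk_vec h *m mon la 0 1 = (K 0 1 * \prod_n (la - xish n (h n))) *: Sk_vec h.
Proof.
move: h; apply: (occupation_ind (P := fun h => _)).
  move=> la _; rewrite Sk_vec0 covac_monB; congr ((_ * _) *: _).
  by apply: eq_bigr => n _; rewrite ffunE.
move=> h n hm hn IH _ la lau.
have la_n : la != xish n (h n) by apply: lau; rewrite incr_in.
have lau' p k : (k < h p)%N -> la != xish p k.
  by move=> kh; apply: lau; rewrite ffunE; case: eqP => // _; apply: ltnW.
rewrite Sk_vec_incr -scalemxAl (RTT_AB (RTT_mon K) la_n (IH _ lau')); last first.
  rewrite IH => [|p k kh].
    by rewrite (bigD1 n) //= subrr mul0r mulr0 scale0r.
  rewrite xish_neq //; first exact: leq_trans (ltnW kh) (hm p).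
  by apply: contraTneq kh => -[<- <-]; rewrite ltnn.
rewrite !scalerA mulrC; congr ((_ * _) *: _).
rewrite (bigD1 n) //= [in RHS](bigD1 n) //= incr_in xishS.
rewrite [in RHS](eq_bigr (fun p => la - xish p (h p))) => [|p pn]; last first.
  by rewrite incr_out.
by have : la - xish n (h n) != 0; [rewrite subr_eq0 | move=> ?; field].
Qed.

Lemma Sk_vecB0 h n : (forall p, h p <= m p)%N ->
  Sk_vec h *m mon (xish n (h n)) 0 1 = 0.
Proof.
move=> hm; rewrite Sk_vecB // => [|p k kh].
  by rewrite (bigD1 n) //= subrr mul0r mulr0 scale0r.
rewrite xish_neq //; first exact: leq_trans (ltnW kh) (hm p).
by apply: contraTneq kh => -[<- <-]; rewrite ltnn.
Qed.

(** Holds on the vacuum since $d(\xi_n^{(0)})=0$, and is transported by [RTT_AD] through the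
    operators $\mathsf A$ of the other sites. *)
Lemma Sk_vecD0 h n : (forall p, h p <= m p)%N -> h n = 0%N ->
  Sk_vec h *m mon (xish n 0) 1 1 = 0.
Proof.
move: h; apply: (occupation_ind (P := fun h => _)).
  by rewrite Sk_vec0 covac_monD dfun_0 mulr0 scale0r.
move=> h p hm hp IH _; rewrite ffunE; case: eqP => // /eqP np hn.
rewrite Sk_vec_incr -scalemxAl (RTT_AD (RTT_mon K)) ?scaler0 //.
- by rewrite xi_gen // ltnW.
- by have := Sk_vecB0 n hm; rewrite hn.
- by rewrite Sk_vecB0.
exact: IH.
Qed.

(** With $u=\xi_n^{(h_n+1)}$, the covector is killed by $\mathsf B(u+\eta)$, so $\mathsf
    A(u+\eta)\mathsf D(u)$ acts as the quantum determinant $\mathsf k_1\mathsf k_2\,a(u+\eta)d(u)$;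
    the normalization cancels $\mathsf k_1a(u+\eta)$. *)
Lemma Sk_vecDS h n : (forall p, h p <= m p)%N -> (h n < m n)%N ->
  Sk_vec (incr h n) *m mon (xish n (h n).+1) 1 1 =
  (k2 * dfun (xish n (h n).+1)) *: Sk_vec h.
Proof.
move=> hm hn; rewrite Sk_vec_incr -scalemxAl.
have e : xish n (h n) = xish n (h n).+1 + eta by rewrite xishS subrK.
have B0 := Sk_vecB0 n hm; rewrite e in B0.
rewrite e (qdet_row eta0 (RTT_mon K) B0).
rewrite qdet_mon detK mul_mx_scalar scalerA; congr (_ *: _).
by have := afun_neq0 hn; rewrite e => ?; field; apply/andP.
Qed.

Lemma Sk_vec_neq0 h : (forall p, h p <= m p)%N -> Sk_vec h != 0.
Proof.
move: h; apply: (occupation_ind (P := fun h => _)).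
  by rewrite Sk_vec0 covac_neq0.
move=> h n hm hn IH _; apply: contraNneq IH => S0.
have := Sk_vecDS hm hn; rewrite S0 mul0mx => /esym/eqP.
by rewrite scaler_eq0 mulf_eq0 (negPf k20) (negPf (dfun_neq0 _)).
Qed.

Lemma Sk_vec_free (K01 : K 0 1 != 0) (c : label -> C) :
  \sum_l c l *: Sklyanin_covector m eta xi k1 K l = 0 -> forall l, c l = 0.
Proof.
pose occ_of (h : label) : occ := [ffun n => h n : nat].
have occ_le (h : label) p : (occ_of h p <= m p)%N by rewrite ffunE -ltnS.
have SkE (h : label) : Sklyanin_covector m eta xi k1 K h = Sk_vec (occ_of h).
  by congr (_ *m _); apply: eq_bigr => n _; rewrite ffunE.
pose b (h : label) : {poly C} := \prod_n ('X - (xish n (occ_of h n))%:P).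
(* A nonroot of [p] is a spectral parameter where the eigenvalues of $\mathsf B$ are pairwise
   distinct and which avoids the points excluded in [Sk_vecB]. *)
pose p : {poly C} := (\prod_(hh : label * label | hh.1 != hh.2) (b hh.1 - b hh.2)) *
  \prod_n \prod_(k < m n) ('X - (xish n k)%:P).
have p0 : p != 0.
  rewrite mulf_neq0 //; last first.
    by apply/prodf_neq0 => n _; apply/prodf_neq0 => k _; rewrite polyXsubC_eq0.
  apply/prodf_neq0; case=> h h' /= hh'.
  have [n nh] : exists n, h n != h' n.
    apply/existsP; apply: contraNT hh'; rewrite negb_exists => /forallP H.
    by apply/eqP/ffunP => n; apply/eqP; move: (H n); rewrite negbK.
  rewrite subr_eq0; apply/negP => /eqP bb.
  (* At a site where the labels differ, this point is a root of [b h] but not of [b h']. *)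
  have := congr1 (fun r => r.[xish n (occ_of h n)]) bb; rewrite /= !horner_prod.
  rewrite (bigD1 n) //= !hornerE subrr mul0r => /esym/eqP.
  apply/negP/prodf_neq0 => r _; rewrite !hornerE subr_eq0 xish_neq //.
  apply: contraNneq nh => -[<-]; rewrite !ffunE => hh; exact/eqP/val_inj.
have [la] := closed_nonrootP p p0.
rewrite rootE hornerM mulf_eq0 negb_or !horner_prod.
case/andP=> /prodf_neq0 H1 /prodf_neq0 H2.
under eq_bigr do rewrite SkE.
apply: (eigen_free (B := mon la 0 1) (v := fun l => Sk_vec (occ_of l))
  (a := fun l => K 0 1 * (b l).[la])).
- move=> h h' /(mulfI K01) bb; apply/eqP; apply: contraT => hh.
  by have := H1 (h, h') hh; rewrite !hornerE bb subrr eqxx.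
- move=> h; rewrite Sk_vecB //.
    rewrite /b horner_prod; congr ((_ * _) *: _).
    by apply: eq_bigr => n _; rewrite !hornerE.
  move=> n k kh; have km : (k < m n)%N by apply: leq_trans kh (occ_le h n).
  have := H2 n isT; rewrite horner_prod => /prodf_neq0 /(_ (Ordinal km) isT).
  by rewrite !hornerE subr_eq0.
by move=> h; apply: Sk_vec_neq0.
Qed.

(** Both sides obey the recursion obtained from $\mathsf T=\mathsf A+\mathsf D$ at $\xi_n^{(h_n)}$.
    The cross-multiplied form avoids dividing by $Q_t(\xi_n^{(0)})$. *)
Lemma Sk_vec_wave t Qt v : transfer_eigenvector eta xi K t v ->
  TQ_solution m eta xi k1 k2 t Qt -> forall h : occ, (forall p, h p <= m p)%N ->
  (Sk_vec h *m v) 0 0 * \prod_n Qt.[xish n 0] =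
  (covac C m *m v) 0 0 * \prod_n Qt.[xish n (h n)].
Proof.
move=> [v0 Tv] [_ _ TQ]; apply: (occupation_ind (P := fun h => _)).
  rewrite Sk_vec0; congr (_ * _).
  by apply: eq_bigr => n _; rewrite ffunE.
move=> h n hm hn IH IH'; set x := xish n (h n).
have H0 : k1 * afun x != 0 by rewrite mulf_neq0 // afun_neq0.
set p0 := \prod_n Qt.[xish n 0] in IH IH' *.
set w0 := (covac C m *m v) 0 0 in IH IH' *.
pose pp := \prod_(p | p != n) Qt.[xish p (h p)].
have {}IH : (Sk_vec h *m v) 0 0 * p0 = w0 * (Qt.[x] * pp).
  by rewrite IH (bigD1 n).
(* The $\mathsf D$ term lowers $h_n$; at $h_n=0$ it vanishes together with $d(\xi_n^{(0)})$, so no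
   earlier label is required. *)
have HD : (Sk_vec h *m mon x 1 1 *m v) 0 0 * p0 =
    k2 * dfun x * (w0 * (Qt.[x + eta] * pp)).
  have [hn0 | hn0] := posnP (h n).
    by rewrite /x hn0 Sk_vecD0 // mul0mx mxE dfun_0 mulr0 !mul0r.
  have hn1 : ((decr h n) n).+1 = h n by rewrite ffunE eqxx prednK.
  have dm : (decr h n n < m n)%N by rewrite hn1.
  have := Sk_vecDS (decr_le n hm) dm; rewrite decrK // hn1 -/x => ->.
  rewrite -scalemxAl [X in X * _]mxE -mulrA (IH' hn0).
  rewrite (bigD1 n) //= (_ : xish n (decr h n n) = x + eta); last first.
    by rewrite /x -hn1 xishS subrK.
  do 3 congr (_ * _); apply: eq_bigr => p pn; rewrite ffunE (negPf pn) //.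
have HA := congr1 (fun w : 'cV[C]_q => (Sk_vec h *m w) 0 0) (Tv x).
move: HA; rewrite /= transferE mulmxDl mulmxDr !mulmxA [LHS]mxE Sk_vecA // -/x.
rewrite -scalemxAl -scalemxAr [in X in X + _]mxE [in RHS]mxE => HA.
apply: (mulfI H0); rewrite mulrA; move: HA => /(canRL (addrK _)) ->.
rewrite mulrBl HD -[t.[x] * _ * p0]mulrA IH (bigD1 n) //= incr_in xishS -/x.
rewrite (eq_bigr (fun p => Qt.[xish p (h p)])) => [|p pn]; last by rewrite incr_out.
rewrite -/pp; have := TQ x => /(canLR (addrK _)) TQx.
transitivity (w0 * pp * (k1 * afun x * Qt.[x - eta])); last by ring.
rewrite -TQx; ring.
Qed.

(** A zero at $\xi_n^{(0)}$ would propagate through the TQ equation down to $\xi_n^{(2s_n)}$, where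
    $Q_t$ is nonzero. *)
Lemma TQ_bottom_neq0 t Qt : TQ_solution m eta xi k1 k2 t Qt ->
  forall n, Qt.[xish n 0] != 0.
Proof.
move=> [_ Qm TQ] n; apply: contraNneq (Qm n) => Q0.
(* The recursion has order two, so two consecutive zeros are carried; at 0 the truncated predecessor
   makes them coincide. *)
suff: (m n <= m n)%N -> Qt.[xish n (m n)] = 0 /\ Qt.[xish n (m n).-1] = 0.
  by case=> // -> _.
elim: {1 3 4}(m n) => [//|k IH km].
have [Qk Qk1] := IH (ltnW km); split; last by [].
have k1a : k1 * afun (xish n k) != 0 by rewrite mulf_neq0 // afun_neq0.
apply: (mulfI k1a); rewrite mulr0.
have := TQ (xish n k); rewrite -xishS Qk mulr0.
case: k Qk Qk1 {IH km k1a} => [|k] Qk Qk1.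
  by rewrite dfun_0 mulr0 mul0r addr0 => <-.
by rewrite {3}xishS subrK /= in Qk1 *; rewrite Qk1 mulr0 addr0 => <-.
Qed.

End Sklyanin.

(** * Fusion *)

Section Words.

Definition wt l (f : {ffun 'I_l -> 'I_2}) : nat := #|[set k | f k == 1]|.

Lemma wtE l (f : {ffun 'I_l -> 'I_2}) : wt f = (\sum_i (f i == 1%R))%N.
Proof.
by rewrite /wt -sum1dep_card [LHS]big_mkcond; apply: eq_bigr => i _; case: eqP.
Qed.

Lemma wt_le l (f : {ffun 'I_l -> 'I_2}) : (wt f <= l)%N.
Proof. by rewrite /wt (leq_trans (max_card _)) ?card_ord. Qed.

Lemma wt_count l (f : {ffun 'I_l -> 'I_2}) : wt f = count_mem 1 (map f (enum 'I_l)).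
Proof. by rewrite wtE count_map -sum1_count big_enum_cond big_mkcondr. Qed.

Lemma perm_eq_ord2 (s t : seq 'I_2) :
  size s = size t -> count_mem 1 s = count_mem 1 t -> perm_eq s t.
Proof.
move=> st c1; have E (r : seq 'I_2) : (count_mem 0%R r + count_mem 1%R r)%N = size r.
  rewrite -(count_predC (pred1 (0 : 'I_2)) r); congr (_ + _)%N; apply: eq_count => x /=.
  by case: (ord2P x) => ->.
apply/allP => x _ /=; case: (ord2P x) => ->; apply/eqP; last exact: c1.
by apply/eqP; rewrite -(eqn_add2r (count_mem (1 : 'I_2) s)) {2}c1 !E st.
Qed.

Lemma wt_perm l (f : {ffun 'I_l -> 'I_2}) (s : 'S_l) : wt [ffun i => f (s i)] = wt f.
Proof.
rewrite !wtE [RHS](reindex_inj (@perm_inj _ s)); apply: eq_bigr => i _.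
by rewrite ffunE.
Qed.

(** With two letters, the weight is a complete invariant of the orbits of the symmetric group. *)
Lemma wt_eqP l (f g : {ffun 'I_l -> 'I_2}) :
  wt f = wt g -> exists s : 'S_l, forall i, g i = f (s i).
Proof.
move=> fg; have /tuple_permP[s es] :
    perm_eq (map_tuple g (ord_tuple l)) (map_tuple f (ord_tuple l)).
  by apply: perm_eq_ord2; rewrite ?size_map //= -!wt_count.
exists s => i; have := congr1 (fun t => nth 0 t i) es => /=.
rewrite (nth_map i) ?size_enum_ord // nth_ord_enum (nth_map i) ?size_enum_ord //.
by rewrite nth_ord_enum tnth_map tnth_ord_tuple.
Qed.

(** The representative of weight [j] with its letters 1 in front, so that [word l.+1 j.+1] unfolds
    to [1 :: word l j]. *)
Definition word l j : seq 'I_2 := nseq j 1 ++ nseq (l - j) 0.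

Lemma size_word l j : (j <= l)%N -> size (word l j) = l.
Proof. by move=> jl; rewrite size_cat !size_nseq subnKC. Qed.

Lemma count_word l j : count_mem 1 (word l j) = j.
Proof. by rewrite count_cat !count_nseq /= mul1n mul0n addn0. Qed.

Lemma ex_wt l k : (k <= l)%N -> exists f : {ffun 'I_l -> 'I_2}, wt f = k.
Proof.
move=> kl; exists [ffun i : 'I_l => nth 0 (word l k) i].
rewrite wt_count -[RHS](count_word l k); congr (count _ _).
apply: (@eq_from_nth _ 0) => [|i]; rewrite size_map size_enum_ord ?size_word // => il.
by rewrite (nth_map (Ordinal il)) ?size_enum_ord // ffunE nth_enum_ord.
Qed.

Definition cons_ffun l (p : 'I_2 * {ffun 'I_l -> 'I_2}) : {ffun 'I_l.+1 -> 'I_2} :=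
  [ffun i => if unlift ord0 i is Some j then p.2 j else p.1].

Lemma cons_ffun0 l p : @cons_ffun l p ord0 = p.1.
Proof. by rewrite ffunE unlift_none. Qed.

Lemma cons_ffunS l p i : @cons_ffun l p (lift ord0 i) = p.2 i.
Proof. by rewrite ffunE liftK. Qed.

Lemma cons_ffun_bij l : bijective (@cons_ffun l).
Proof.
exists (fun f : {ffun 'I_l.+1 -> 'I_2} => (f ord0, [ffun i : 'I_l => f (lift ord0 i)])).
  case=> a f; congr pair; first exact: cons_ffun0.
  by apply/ffunP => i; rewrite ffunE cons_ffunS.
move=> f; apply/ffunP => i; case: (unliftP ord0 i) => [j|] ->.
  by rewrite cons_ffunS ffunE.
by rewrite cons_ffun0.
Qed.

Lemma wt_cons l p : wt (@cons_ffun l p) = ((p.1 == 1%R) + wt p.2)%N.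
Proof.
rewrite !wtE big_ord_recl cons_ffun0; congr (_ + _)%N.
by apply: eq_bigr => i _; rewrite cons_ffunS.
Qed.

End Words.

(** * Matrix elements of the symmetric projector *)

Section SymProj.
Variables (C : numClosedFieldType) (l : nat).
Implicit Types f g h : {ffun 'I_l -> 'I_2}.

Definition wt_card (k : nat) : C := #|[set f : {ffun 'I_l -> 'I_2} | wt f == k]|%:R.

Lemma wt_card_neq0 k : (k <= l)%N -> wt_card k != 0.
Proof.
move=> kl; rewrite pnatr_eq0 -lt0n; apply/card_gt0P.
by have [f fk] := ex_wt kl; exists f; rewrite inE fk.
Qed.

Lemma wt_cardE k : \sum_(f : {ffun 'I_l -> 'I_2} | wt f == k) 1 = wt_card k.
Proof.
by rewrite sumr_const /wt_card; congr (_ *+ _); apply: eq_card => f; rewrite inE.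
Qed.

Lemma sym_projE f g : sym_proj C f g = if wt f == wt g then (wt_card (wt f))^-1 else 0.
Proof.
pose n f g : C := \sum_(s : 'S_l) ([forall i, f (s i) == g i])%:R.
have n0 f1 g1 : wt f1 != wt g1 -> n f1 g1 = 0.
  move=> fg; rewrite /n big1 // => s _; case: forallP => // H.
  case/eqP: fg; rewrite -(wt_perm f1 s); congr wt.
  by apply/ffunP => i; rewrite ffunE; apply/eqP.
have nE g1 : wt f == wt g1 -> n f g1 = n f f.
  move=> /eqP/wt_eqP[t tE]; rewrite /n (reindex_inj (mulgI t)).
  apply: eq_bigr => s _; congr (nat_of_bool _)%:R; apply/forallP/forallP => H i.
    by have := H (t^-1%g i); rewrite permM tE permKV.
  by rewrite permM tE.
(* Orbit-stabiliser count: each permutation sends [f] to exactly one word, and all words of the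
   orbit are reached equally often. *)
have nn : wt_card (wt f) * n f f = l`!%:R.
  rewrite -wt_cardE mulr_suml.
  rewrite (eq_bigr (n f)) => [|g1 g1P]; last by rewrite mul1r nE // eq_sym.
  transitivity (\sum_g1 n f g1).
    rewrite [RHS](bigID (fun g1 => wt g1 == wt f)) /= [X in _ + X]big1 ?addr0 //.
    by move=> g1 fg; rewrite n0 // eq_sym.
  rewrite /n exchange_big /= (eq_bigr (fun _ => 1)) => [|s _].
    by rewrite sumr_const card_Sn.
  rewrite (bigD1 [ffun i => f (s i)]) //= big1 ?addr0 => [|g1 g1N].
    by case: forallP => // -[] i; rewrite ffunE.
  case: forallP => // H; case/eqP: g1N; apply/ffunP => i; rewrite ffunE.
  by apply/esym/eqP.
rewrite /sym_proj -/(n f g); case: ifP => [fg | /negbT fg]; last by rewrite n0 ?mulr0.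
have f0 := wt_card_neq0 (wt_le f).
have l0 : l`!%:R != 0 :> C by rewrite pnatr_eq0 -lt0n fact_gt0.
by apply: (mulfI l0); apply: (mulfI f0); rewrite nE // mulVKf // nn mulrCA divff // mulr1.
Qed.

Lemma sym_proj_idem g h : \sum_f sym_proj C f g * sym_proj C h f =
  if wt g == wt h then (wt_card (wt h))^-1 else 0.
Proof.
case: ifP => [/eqP gh | gh]; last first.
  rewrite big1 // => f _; rewrite !sym_projE; case: eqP => [-> |]; last by rewrite mul0r.
  by rewrite eq_sym gh mulr0.
rewrite (bigID (fun f => wt f == wt h)) /= addrC big1 ?add0r => [|f fh]; last first.
  by rewrite !sym_projE gh (negPf fh) mul0r.
rewrite (eq_bigr (fun _ => 1 * ((wt_card (wt h))^-1 * (wt_card (wt h))^-1)))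
  => [|f /eqP fh].
  by rewrite -mulr_suml wt_cardE mulVKf // wt_card_neq0 // wt_le.
by rewrite !sym_projE gh fh eqxx mul1r.
Qed.

End SymProj.

(** * The fusion recursion *)

Section Fusion.
Variables (C : numClosedFieldType) (eta : C) (eta0 : eta != 0) (q : nat).
Variables (M : C -> 'M['M[C]_q]_2) (RM : RTT eta M).
Variable la : C.

(* The sum, over the words f having k letters 1, of the coefficients
   M_{f_1 g_1}(la + (l-1) eta) ... M_{f_l g_l}(la). *)
Fixpoint symsum (k : nat) (g : seq 'I_2) : 'M[C]_q :=
  if g is x :: g' then
    M (la + (size g')%:R * eta) 0 x *m symsum k g' +
    (if k is k'.+1 then M (la + (size g')%:R * eta) 1 x *m symsum k' g' else 0)
  else (k == 0%N)%:R%:M.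

Lemma symsum_big k g : (size g < k)%N -> symsum k g = 0.
Proof.
elim: g k => [|x g IH] [|k] //= gk.
  by rewrite raddf0.
by rewrite !IH ?mulmx0 ?addr0 // ltnW.
Qed.

Lemma symsum_cons x g g' : size g = size g' -> symsum^~ g =1 symsum^~ g' ->
  symsum^~ (x :: g) =1 symsum^~ (x :: g').
Proof. by move=> sg E [|k] /=; rewrite sg !E. Qed.

(* The R-matrix degenerates to a symmetriser when the two spectral parameters
   differ by eta. *)
Lemma symsum_swap x y g : symsum^~ (x :: y :: g) =1 symsum^~ (y :: x :: g).
Proof.
pose u := la + (size g)%:R * eta.
have E : la + (size g).+1%:R * eta = u + eta by rewrite -addn1 natrD /u; ring.
have R0 z t := RTT_same_row eta0 u 0 z t RM.
have R1 z t := RTT_same_row eta0 u 1 z t RM.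
have RX z t : M (u + eta) 0 z *m M u 1 t + M (u + eta) 1 z *m M u 0 t =
    M (u + eta) 0 t *m M u 1 z + M (u + eta) 1 t *m M u 0 z.
  have F : M (u + eta) 0 0 *m M u 1 1 + M (u + eta) 1 0 *m M u 0 1 =
      M (u + eta) 0 1 *m M u 1 0 + M (u + eta) 1 1 *m M u 0 0.
    have /eqP := qdetE eta0 u RM; rewrite /qdet eq_sym subr_eq => /eqP ->.
    by rewrite addrAC subrK addrC.
  by case: (ord2P z) => ->; case: (ord2P t) => ->.
move=> k /=; rewrite -/u E; move: (u + eta) R0 R1 RX {E} => u' R0 R1 RX.
case: k => [|[|k]] /=.
- by rewrite !addr0 !mulmxA R0.
- rewrite !addr0 !mulmxDr !mulmxA -!addrA; congr (_ + _); first by rewrite R0.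
  by rewrite -!mulmxDl RX.
rewrite !mulmxDr !mulmxA -!addrA; congr (_ + _); first by rewrite R0.
by rewrite !addrA -!mulmxDl RX R1.
Qed.

Lemma symsum_insert x s t : symsum^~ (x :: s ++ t) =1 symsum^~ (s ++ x :: t).
Proof.
elim: s => [//|y s IH] k.
rewrite symsum_swap; apply: symsum_cons k; last exact: IH.
by rewrite /= !size_cat addnS.
Qed.

Lemma symsum_perm s t : perm_eq s t -> symsum^~ s =1 symsum^~ t.
Proof.
elim: s t => [|x s IH] t st k.
  by move: st; rewrite perm_sym => /perm_nilP ->.
have xt : x \in t by rewrite -(perm_mem st) mem_head.
move: st; case/splitPr: xt => t1 t2.
rewrite perm_sym perm_catC /= perm_cons perm_catC => st.
rewrite perm_sym in st.
rewrite -symsum_insert; apply: symsum_cons; last exact: IH.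
exact: perm_size.
Qed.

Lemma symsum_word k l g : size g = l -> symsum k g = symsum k (word l (count_mem 1 g)).
Proof.
move=> gl; apply: symsum_perm; apply: perm_eq_ord2; rewrite ?count_word //.
by rewrite size_word // -gl count_size.
Qed.

Definition symsum_pred k g : 'M[C]_q := if k is k'.+1 then symsum k' g else 0.

Lemma symsum_consE k x g : symsum k (x :: g) =
  M (la + (size g)%:R * eta) 0 x *m symsum k g +
  M (la + (size g)%:R * eta) 1 x *m symsum_pred k g.
Proof. by case: k => [|k] /=; rewrite ?mulmx0. Qed.

(** The trace over symmetric tensors, with one diagonal coefficient per weight. *)
Definition symtrace l : 'M[C]_q := \sum_(k < l.+1) symsum k (word l k).

Lemma symtrace0 : symtrace 0 = 1%:M.
Proof. by rewrite /symtrace big_ord1. Qed.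

Lemma symtrace1 : symtrace 1 = M la 0 0 + M la 1 1.
Proof.
rewrite /symtrace big_ord_recl big_ord1 /= mul0r !addr0 !mulmx1.
by rewrite raddf0 mulmx0 add0r.
Qed.

Lemma symsum_word0 k l j : (j <= l)%N ->
  symsum k (word l.+1 j) = symsum k (0 :: word l j).
Proof.
move=> jl; apply: symsum_perm; apply: perm_eq_ord2.
  by rewrite /= !size_word // ltnW.
by rewrite /= !count_word.
Qed.

Local Arguments symsum : simpl never.
Local Arguments word : simpl never.

Lemma symtrace_rec l : let u := la + l%:R * eta in
  symtrace l.+2 = (M (u + eta) 0 0 + M (u + eta) 1 1) *m symtrace l.+1 -
    qdet eta M u *m symtrace l.
Proof.
move=> u; have E : la + l.+1%:R * eta = u + eta by rewrite /u -addn1 natrD; ring.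
have Eu : la + l%:R * eta = u by [].
clearbody u.
(* The first letter is chosen to be 0 for every weight below the top one, where it can only be 1. *)
have -> : symtrace l.+2 =
    M (u + eta) 0 0 *m symtrace l.+1 +
    \sum_(k < l.+2) M (u + eta) 1 0 *m symsum_pred k (word l.+1 k) +
    M (u + eta) 1 1 *m symsum l.+1 (word l.+1 l.+1).
  rewrite {1}/symtrace big_ord_recr /=; congr (_ + _).
    rewrite /symtrace mulmx_sumr -big_split; apply: eq_bigr => k _ /=.
    by rewrite symsum_word0 // -1?ltnS // symsum_consE size_word -1?ltnS // E.
  rewrite -[word l.+2 l.+2]/(1 :: word l.+1 l.+1) symsum_consE size_word // E /=.
  by rewrite symsum_big ?size_word // mulmx0 add0r.
rewrite mulmxDl -!addrA; congr (_ + _).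
rewrite [symtrace l.+1]/symtrace [in RHS]big_ord_recr /=.
move: (symsum l.+1 (word l.+1 l.+1)) => Y; rewrite mulmxDr [RHS]addrAC; congr (_ + _).
rewrite big_ord_recl /= mulmx0 add0r.
apply/eqP; rewrite eq_sym subr_eq [X in _ == X]addrC -subr_eq; apply/eqP.
rewrite !mulmx_sumr -sumrB; apply: eq_bigr => k _ /=.
have kl : (k <= l)%N by rewrite -ltnS.
rewrite symsum_word0 // -[word l.+1 k.+1]/(1 :: word l k) !symsum_consE size_word // Eu.
move: (symsum k _) (symsum_pred k _) => s1 s2.
(* The same-row relation cancels the two terms in [s2]; those in [s1] combine into the quantum
   determinant. *)
rewrite !mulmxDr !mulmxA (RTT_same_row eta0 u 1 1 0 RM).
by rewrite opprD addrACA subrr addr0 /qdet mulmxBl.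
Qed.

Definition wprod l (f g : {ffun 'I_l -> 'I_2}) : 'M[C]_q :=
  \prod_(i < l) M (la + (l.-1 - i)%:R * eta) (f i) (g i).

Lemma sum_wprod l k (g : {ffun 'I_l -> 'I_2}) :
  \sum_(f | wt f == k) wprod f g = symsum k (map g (enum 'I_l)).
Proof.
elim: l k g => [|l IH] k g.
  have E0 : enum 'I_0 = [::] by apply: size0nil; rewrite size_enum_ord.
  have w0 (f : {ffun 'I_0 -> 'I_2}) : wt f = 0%N by rewrite wtE big_ord0.
  rewrite E0 big_mkcond (big_pred1 [ffun=> 0]) /= => [|f]; last first.
    by apply/esym/eqP/ffunP; case.
  rewrite w0 eq_sym -[symsum k [::]]/((k == 0%N)%:R%:M).
  case: eqP => _; last by rewrite /= raddf0.
  by rewrite /wprod big_ord0.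
rewrite (reindex _ (onW_bij _ (@cons_ffun_bij l))) /=.
pose g' : {ffun 'I_l -> 'I_2} := [ffun i => g (lift ord0 i)].
have -> : map g (enum 'I_l.+1) = g ord0 :: map g' (enum 'I_l).
  rewrite enum_ordSl /= -map_comp; congr (_ :: _).
  by apply: eq_map => i; rewrite /= ffunE.
have wprodS p : wprod (cons_ffun p) g =
    M (la + l%:R * eta) p.1 (g ord0) *m wprod p.2 g'.
  rewrite /wprod big_ord_recl subn0 cons_ffun0; congr (_ *m _).
  apply: eq_bigr => i _; rewrite cons_ffunS ffunE lift0 /=.
  by rewrite subnS -predn_sub.
rewrite symsum_consE size_map size_enum_ord.
rewrite (eq_bigl (fun p : 'I_2 * {ffun 'I_l -> 'I_2} =>
  true && ((p.1 == 1%R) + wt p.2 == k)%N)); last by move=> p; rewrite wt_cons.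
rewrite (eq_bigr _ (fun p _ => wprodS p)).
rewrite -(pair_big_dep xpredT (fun a f => (a == 1%R) + wt f == k)%N
  (fun a f => M (la + l%:R * eta) a (g ord0) *m wprod f g')) sum2E /=.
rewrite -!mulmx_sumr -IH; congr (_ + _).
case: k => [|k]; first by rewrite big_pred0 ?mulmx0.
by rewrite /= -IH.
Qed.

Lemma symsum_map l (g : {ffun 'I_l -> 'I_2}) k :
  symsum k (map g (enum 'I_l)) = symsum k (word l (wt g)).
Proof. by rewrite wt_count; apply: symsum_word; rewrite size_map size_enum_ord. Qed.

(** The projector averages over words of equal weight. The resulting coefficient depends on [h] only
    through its weight, so the inverse cardinality cancels the number of such words. *)
Lemma symtrace_proj l :
  \sum_(f : {ffun 'I_l -> 'I_2}) \sum_(g : {ffun 'I_l -> 'I_2})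
    \sum_(h : {ffun 'I_l -> 'I_2})
      (sym_proj C f g * sym_proj C h f) *: wprod g h = symtrace l.
Proof.
under eq_bigr do rewrite exchange_big /=; rewrite exchange_big /=.
transitivity (\sum_(h : {ffun 'I_l -> 'I_2})
    (wt_card C l (wt h))^-1 *: symsum (wt h) (word l (wt h))).
  apply: eq_bigr => h _; rewrite exchange_big /= -symsum_map -sum_wprod scaler_sumr.
  rewrite [RHS]big_mkcond; apply: eq_bigr => g _.
  rewrite -scaler_suml sym_proj_idem; case: ifP => // _; exact: scale0r.
rewrite (partition_big (fun h => inord (wt h) : 'I_l.+1) xpredT) //=.
apply: eq_bigr => k _.
have kl : (k <= l)%N by rewrite -ltnS.
rewrite (eq_bigl (fun h : {ffun 'I_l -> 'I_2} => wt h == k)) => [|h]; last first.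
  by rewrite -val_eqE /= inordK // ltnS wt_le.
rewrite (eq_bigr (fun _ => 1 *: ((wt_card C l k)^-1 *: symsum k (word l k))))
  => [|h /eqP ->].
  by rewrite -scaler_suml wt_cardE scalerA divff ?scale1r // wt_card_neq0.
by rewrite scale1r.
Qed.

End Fusion.

Lemma fused_transferE (C : numClosedFieldType) (eta : C) (eta0 : eta != 0)
    (N : nat) (m : 'I_N -> nat) (xi : 'I_N -> C) (K : 'M[C]_2) l la :
  fused_transfer m eta xi K l la = symtrace eta (monodromy m eta xi K) la l.
Proof.
rewrite /fused_transfer; case: eqP => [-> | _]; first by rewrite symtrace0.
exact/symtrace_proj/RTT_mon.
Qed.

(** * Gauge transformations *)

Section SymPow.
Variables (C : numClosedFieldType) (m : nat).
Local Notation F := {ffun 'I_m -> 'I_2}.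
Local Notation E := (@sym_tens_coef C m).
Local Notation binC a := ('C(m, a)%:R : C).
Implicit Types (f g : F) (W : 'M[C]_2) (phi psi : F -> C).

Lemma wt_card_bin k : wt_card C m k = binC k.
Proof.
rewrite /wt_card -[in 'C(m, _)](card_ord m) -card_draws; congr _%:R.
pose s f := [set i | f i == 1%R].
have s_inj : injective s.
  move=> f g fg; apply/ffunP => i; have := congr1 (fun A : {set 'I_m} => i \in A) fg.
  rewrite !inE; case: (ord2P (f i)) => ->; case: (ord2P (g i)) => -> //.
rewrite -(card_imset _ s_inj); apply: eq_card => A; rewrite inE.
apply/imsetP/idP => [[f] | Ak]; first by rewrite inE => fk ->.
exists [ffun i => if i \in A then 1%R else 0%R].
  rewrite inE /wt -(eqP Ak); apply/eqP/eq_card => i; rewrite !inE ffunE.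
  by case: ifP.
by apply/setP => i; rewrite inE ffunE; case: ifP.
Qed.

Lemma binC_neq0 (i : 'I_m.+1) : binC i != 0.
Proof. by rewrite pnatr_eq0 -lt0n bin_gt0 -ltnS. Qed.

Lemma sym_coefE i f : E i f = (wt f == i)%:R * (sqrtC (binC i))^-1.
Proof. by rewrite /sym_tens_coef -/(wt f); case: eqP; rewrite ?mul1r ?mul0r. Qed.

Lemma sum_coef f (G : 'I_m.+1 -> C) :
  \sum_i E i f * G i = (sqrtC (binC (wt f)))^-1 * G (inord (wt f)).
Proof.
have wf : (wt f < m.+1)%N by rewrite ltnS wt_le.
rewrite (bigD1 (inord (wt f))) //= big1 ?addr0 => [|i iw].
  by rewrite sym_coefE inordK // eqxx mul1r.
rewrite sym_coefE; case: eqP => [e|_]; last by rewrite !mul0r.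
by case/eqP: iw; apply/val_inj; rewrite /= inordK.
Qed.

(** The left side is the symmetric projector applied to [phi]: the squared normalization $1/\binom
    mk$ cancels the number of words of weight $k$. *)
Lemma sym_coef_sym phi f : (forall g, wt g = wt f -> phi g = phi f) ->
  \sum_i E i f * \sum_g E i g * phi g = phi f.
Proof.
move=> phiS; rewrite sum_coef.
have wf : (wt f < m.+1)%N by rewrite ltnS wt_le.
have b0 := binC_neq0 (Ordinal wf); rewrite /= in b0.
have s0 : sqrtC (binC (wt f)) != 0 by rewrite sqrtC_eq0.
rewrite (eq_bigr (fun g =>
    if wt g == wt f then 1 * (sqrtC (binC (wt f)))^-1 * phi f else 0)).
  rewrite -big_mkcond -!mulr_suml wt_cardE wt_card_bin.
  by rewrite -{2}[binC _]sqrtCK; field.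
move=> g _; rewrite sym_coefE inordK //; case: eqP => [/phiS -> // |].
by rewrite !mul0r.
Qed.

Lemma sym_coef_ortho i j : \sum_f E i f * E j f = (i == j)%:R.
Proof.
have s0 : sqrtC (binC i) != 0 by rewrite sqrtC_eq0 binC_neq0.
rewrite (eq_bigr (fun f => if wt f == i then
    1 * ((i == j)%:R * ((sqrtC (binC i))^-1 * (sqrtC (binC i))^-1)) else 0)).
  rewrite -big_mkcond -!mulr_suml wt_cardE wt_card_bin.
  by rewrite -{1}[binC _]sqrtCK; field.
move=> f _; rewrite !sym_coefE; case: eqP => [-> |]; last by rewrite !mul0r.
have [<- | ij] := eqVneq i j; first by rewrite eqxx !mul1r.
by rewrite val_eqE (negPf ij) !(mul0r, mulr0).
Qed.

Lemma tens_pow_mul W W' f g :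
  \sum_h tens_pow_coef W f h * tens_pow_coef W' h g = tens_pow_coef (W *m W') f g.
Proof.
rewrite /tens_pow_coef; under [RHS]eq_bigr do rewrite mxE.
by rewrite bigA_distr_bigA; apply: eq_bigr => h _; rewrite -big_split.
Qed.

(** $W^{\otimes m}$ commutes with permutations of the factors, hence preserves symmetric tensors. *)
Lemma tens_pow_sym W j f g : wt g = wt f ->
  \sum_h tens_pow_coef W g h * E j h = \sum_h tens_pow_coef W f h * E j h.
Proof.
move=> /wt_eqP[s sE].
have sK : cancel (fun h : F => [ffun i => h (s i)])
    (fun h : F => [ffun i => h (s^-1%g i)]).
  by move=> h; apply/ffunP => i; rewrite !ffunE permKV.
rewrite [RHS](reindex_inj (can_inj sK)) /=; apply: eq_bigr => h _.
rewrite !sym_coefE wt_perm; congr (_ * _).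
rewrite /tens_pow_coef [RHS]/=; under [RHS]eq_bigr do rewrite ffunE sE.
rewrite [RHS](reindex_inj (@perm_inj _ s^-1%g)) //=.
by apply: eq_bigr => i _; rewrite permKV.
Qed.

Lemma sym_powE W i j :
  sym_pow m W i j = \sum_f E i f * \sum_g tens_pow_coef W f g * E j g.
Proof.
rewrite mxE; apply: eq_bigr => f _; rewrite mulr_sumr.
by apply: eq_bigr => g _; rewrite mulrA.
Qed.

Lemma sym_powE2 W i j :
  sym_pow m W i j = \sum_g (\sum_f E i f * tens_pow_coef W f g) * E j g.
Proof.
by rewrite mxE exchange_big; apply: eq_bigr => g _; rewrite mulr_suml.
Qed.

(** The symmetric projector standing between the two tensor powers acts as the identity, because the
    second power preserves symmetric tensors. *)
Lemma sym_powM W W' : sym_pow m W *m sym_pow m W' = sym_pow m (W *m W').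
Proof.
apply/matrixP => i j; rewrite mxE.
transitivity (\sum_g (\sum_f E i f * tens_pow_coef W f g) *
    \sum_k E k g * \sum_f E k f * \sum_h tens_pow_coef W' f h * E j h).
  under eq_bigr => k _ do rewrite sym_powE2 sym_powE mulr_suml.
  rewrite exchange_big; apply: eq_bigr => g _ /=.
  by rewrite mulr_sumr; apply: eq_bigr => k _; rewrite mulrA.
rewrite sym_powE; under eq_bigr => g _.
  rewrite (sym_coef_sym (phi := fun f => \sum_h tens_pow_coef W' f h * E j h)); last first.
    by move=> f; apply: tens_pow_sym.
  rewrite mulr_suml; over.
rewrite exchange_big; apply: eq_bigr => f _ /=.
under eq_bigr do rewrite -mulrA mulr_sumr mulr_sumr.
rewrite exchange_big mulr_sumr; apply: eq_bigr => h _ /=.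
rewrite -tens_pow_mul mulr_suml mulr_sumr; apply: eq_bigr => g _.
by rewrite !mulrA.
Qed.

Lemma sym_pow1 : sym_pow m (1%:M : 'M[C]_2) = 1%:M.
Proof.
apply/matrixP => i j; rewrite sym_powE !mxE -sym_coef_ortho.
apply: eq_bigr => f _; congr (_ * _); rewrite (bigD1 f) //= big1 => [|g gf].
  rewrite addr0 /tens_pow_coef big1 ?mul1r // => k _; rewrite mxE eqxx //.
have [k kf] : exists k, f k != g k.
  apply/existsP; apply: contraNT gf; rewrite negb_exists => /forallP H.
  by apply/eqP/ffunP => k; apply/eqP; move: (H k); rewrite negbK eq_sym.
by rewrite /tens_pow_coef (bigD1 k) //= mxE (negPf kf) !mul0r.
Qed.

Definition upd f (k : 'I_m) (i : 'I_2) : F := [ffun x => if x == k then i else f x].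

Lemma upd_in f k i : upd f k i k = i.
Proof. by rewrite ffunE eqxx. Qed.

Lemma upd_out f k i l : l != k -> upd f k i l = f l.
Proof. by rewrite ffunE => /negPf ->. Qed.

Lemma updK f k i j : f k = j -> upd (upd f k i) k j = f.
Proof. by move=> fk; apply/ffunP => x; rewrite !ffunE; case: eqP => // ->. Qed.

Lemma wt_upd f k i : (wt (upd f k i) + (f k == 1%R) = wt f + (i == 1%R))%N.
Proof.
rewrite !wtE (bigD1 k) //= [X in (_ = X + _)%N](bigD1 k) //= upd_in.
rewrite (eq_bigr (fun x => f x == 1%R : nat)) => [|x xk]; last by rewrite upd_out.
by rewrite addnAC [RHS]addnAC [(_ + (f k == _))%N]addnC.
Qed.

Lemma sum_upd k i j (G : F -> C) :
  \sum_(f : F | f k == j) G (upd f k i) = \sum_(f : F | f k == i) G f.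
Proof.
rewrite [RHS](reindex_onto (fun f => upd f k i) (fun f => upd f k j)) /=; last first.
  by move=> f /eqP fk; apply: updK.
apply: eq_bigl => f; rewrite upd_in eqxx /=.
apply/idP/eqP => [/eqP fk | <-]; first exact: updK.
by rewrite upd_in.
Qed.

(* sum_k E_ji^(k) - m/2 delta_ij *)
Definition tens_spin (i j : 'I_2) phi f : C :=
  \sum_(k | f k == j) phi (upd f k i) - (m%:R / 2) * (i == j)%:R * phi f.

Lemma tens_spin_adj i j phi psi :
  \sum_f psi f * tens_spin i j phi f = \sum_f tens_spin j i psi f * phi f.
Proof.
under eq_bigr do rewrite mulrBr mulr_sumr.
under [RHS]eq_bigr do rewrite mulrBl mulr_suml.
rewrite !sumrB; congr (_ - _); last first.
  by apply: eq_bigr => f _; rewrite [j == i]eq_sym; ring.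
rewrite (exchange_big_dep predT) //= [RHS](exchange_big_dep predT) //=.
apply: eq_bigr => k _.
rewrite -(sum_upd k i j (fun f => psi (upd f k j) * phi f)).
by apply: eq_bigr => f /eqP fk; rewrite updK.
Qed.

(** On a single factor this is $\sum_aW_{ia}WE_{ja}=\sum_aW_{aj}E_{ai}W$, both sides having entries
    $W_{xj}W_{iy}$; one sums over the position of that factor. *)
Lemma tens_spin_pow W phi i j f :
  \sum_a W i a * (\sum_g tens_pow_coef W f g * tens_spin a j phi g) =
  \sum_a W a j * tens_spin i a (fun h => \sum_g tens_pow_coef W h g * phi g) f.
Proof.
pose P k h g := \prod_(l | l != k) W (h l) (g l).
have PE k h g : tens_pow_coef W h g = W (h k) (g k) * P k h g.
  by rewrite /tens_pow_coef (bigD1 k).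
have Pupdl k i' h g : P k (upd h k i') g = P k h g.
  by apply: eq_bigr => l lk; rewrite upd_out.
have Pupdr k i' h g : P k h (upd g k i') = P k h g.
  by apply: eq_bigr => l lk; rewrite upd_out.
have split k (G : F -> C) : \sum_g G g = \sum_a \sum_(g : F | g k == a) G g.
  by rewrite (partition_big (fun g : F => g k) xpredT).
transitivity (\sum_k W (f k) j * (\sum_g tens_pow_coef W (upd f k i) g * phi g) -
   m%:R / 2 * W i j * \sum_g tens_pow_coef W f g * phi g); last first.
  under [RHS]eq_bigr do rewrite mulrBr.
  rewrite sumrB; congr (_ - _); last first.
    rewrite (bigD1 i) //= [X in _ + X]big1 ?addr0 => [|a ai].
      by rewrite eqxx mulr1 [RHS]mulrCA mulrA.
    by rewrite eq_sym (negPf ai) mulr0 mul0r mulr0.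
  rewrite (partition_big f xpredT) //=; apply: eq_bigr => a _.
  by rewrite mulr_sumr; apply: eq_bigr => k /eqP ->.
under eq_bigr => a _.
  under eq_bigr do rewrite mulrBr mulr_sumr.
  rewrite sumrB mulrBr; over.
rewrite sumrB; congr (_ - _); last first.
  rewrite (bigD1 j) //= [X in _ + X]big1 ?addr0 => [|a aj]; last first.
    by rewrite big1 ?mulr0 // => g _; rewrite (negPf aj) mulr0 mul0r mulr0.
  rewrite !mulr_sumr; apply: eq_bigr => g _; rewrite eqxx mulr1; ring.
under eq_bigr => a _ do rewrite (exchange_big_dep predT) //= mulr_sumr.
rewrite exchange_big; apply: eq_bigr => k _ /=.
rewrite (split k) mulr_sumr; apply: eq_bigr => a _.
rewrite -(sum_upd k a j) !mulr_sumr; apply: eq_bigr => g /eqP gk.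
rewrite !(PE k) Pupdl Pupdr !upd_in gk; ring.
Qed.

(** A square-root form of $(a+1)\binom m{a+1}=(m-a)\binom ma$. *)
Lemma sqrt_bin a : (a < m)%N ->
  sqrtC (a.+1 * (m - a))%:R * sqrtC (binC a) = a.+1%:R * sqrtC (binC a.+1).
Proof.
move=> am; rewrite -[a.+1%:R in RHS](sqrCK (ler0n C _)) -!sqrtCM ?nnegrE ?ler0n //.
  by rewrite -!natrM -natrX -natrM -mulnA -mul_bin_left mulnA mulnn.
by rewrite exprn_ge0 ?ler0n.
Qed.

(** Counting the positions with letter [j] gives an integer coefficient, which the ratio of
    normalizations of two symmetric tensors turns into the square roots of the spin matrices. *)
Lemma tens_spin_coef i j b f :
  tens_spin i j (E b) f = \sum_c E c f * spin_mx C m i j c b.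
Proof.
have wf : (wt f < m.+1)%N by rewrite ltnS wt_le.
have c1 : #|[pred k | f k == 1]| = wt f by rewrite /wt; apply: eq_card => k; rewrite !inE.
have c0 : #|[pred k | f k == 0]| = (m - wt f)%N.
  rewrite -c1 -[X in (X - _)%N](card_ord m) -(cardC [pred k | f k == 1]) addKn.
  by apply: eq_card => k; rewrite !inE; case: (ord2P (f k)) => ->.
have tE s : #|[pred k | f k == j]| = s -> tens_spin i j (E b) f =
    s%:R * ((wt f + (i == 1%R) == b + (j == 1%R))%N%:R * (sqrtC (binC b))^-1)
     - m%:R / 2 * (i == j)%:R * E b f.
  move=> <-; congr (_ - _); rewrite mulr_natl -sumr_const.
  apply: eq_bigr => k fk; rewrite sym_coefE; congr (_%:R * _).
  by rewrite -(eqP fk) -(wt_upd f k i) eqn_add2r.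
have bE : (b : nat) != wt f -> E b f = 0.
  by move=> bf; rewrite sym_coefE eq_sym (negPf bf) mul0r.
rewrite sum_coef.
have s0 (k : 'I_m.+1) : sqrtC (binC k) != 0 by rewrite sqrtC_eq0 binC_neq0.
have sf0 : sqrtC (binC (wt f)) != 0 by have := s0 (Ordinal wf).
case: (ord2P i) (ord2P j) tE => -> [] -> tE; rewrite mxE /=.
- rewrite (tE _ c0) /= !addn0 mxE mxE inordK // natrB -1?ltnS // sym_coefE.
  rewrite -val_eqE /= inordK //.
  by case: eqP => [-> | _]; rewrite ?(mulr0n, mulr1n, mul0r, mulr0, subr0) //; field.
- rewrite (tE _ c1) /= addn0 addn1 mulr0 mul0r subr0 !mxE inordK //.
  case: eqP => [e | _]; last by rewrite !(mulr0, mul0r).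
  have bm : (b < m)%N by rewrite -ltnS -e.
  have := sqrt_bin bm; rewrite e => H.
  rewrite e in sf0; rewrite mul1r; apply: (mulfI sf0); apply: (mulfI (s0 b)).
  rewrite mulrCA mulVKf // [RHS]mulrC H; field; exact: s0.
- rewrite (tE _ c0) /= addn0 addn1 mulr0 mul0r subr0 !mxE inordK // eq_sym.
  case: eqP => [e | _]; last by rewrite !(mulr0, mul0r).
  have bm : (wt f < m)%N by rewrite -ltnS -e ltn_ord.
  have sb := s0 b; rewrite e in sb *.
  have H := sqrt_bin bm; have a0 : (wt f).+1%:R != 0 :> C by rewrite pnatr_eq0.
  rewrite mul1r; apply: (mulfI a0); apply: (mulfI sf0); apply: (mulfI sb).
  set s := sqrtC (_ * _)%:R in H *.
  have ss : s * s = (wt f).+1%:R * (m - wt f)%:R by rewrite -expr2 sqrtCK natrM.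
  transitivity (s * (s * sqrtC (binC (wt f)))); first by rewrite [RHS]mulrA ss; field.
  by rewrite H; field.
rewrite (tE _ c1) /= !mxE -val_eqE /= inordK // eqn_add2r sym_coefE.
by case: eqP => [-> | _]; rewrite ?(mulr0n, mulr1n, mul0r, mulr0, subr0, oppr0) //; field.
Qed.

Lemma spin_mx_tr i j b c : spin_mx C m i j b c = spin_mx C m j i c b.
Proof.
have d : Sz C m c b = Sz C m b c.
  by rewrite !mxE eq_sym; case: eqP => // ->.
case: (ord2P i) => ->; case: (ord2P j) => ->; rewrite !mxE /= ?mxE //;
  by move: d; rewrite !mxE => ->.
Qed.

(** The restriction of [tens_spin_pow] to symmetric tensors. *)
Lemma sym_pow_spin W i j :
  \sum_a W i a *: (sym_pow m W *m spin_mx C m a j) =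
  \sum_a W a j *: (spin_mx C m i a *m sym_pow m W).
Proof.
apply/matrixP => b d; rewrite !summxE.
transitivity (\sum_f E b f * \sum_a W i a *
    \sum_g tens_pow_coef W f g * tens_spin a j (E d) g).
  under [RHS]eq_bigr do rewrite mulr_sumr.
  rewrite [RHS]exchange_big; apply: eq_bigr => a _ /=; rewrite mxE [(_ *m _) _ _]mxE.
  under [X in _ * X = _]eq_bigr => c _ do rewrite sym_powE mulr_suml.
  rewrite exchange_big mulr_sumr; apply: eq_bigr => f _ /=.
  rewrite mulrCA; congr (_ * _).
  under [X in _ = _ * X]eq_bigr do rewrite tens_spin_coef mulr_sumr.
  rewrite exchange_big mulr_sumr; apply: eq_bigr => c _ /=.
  rewrite -mulrA; congr (_ * _); rewrite mulr_suml; apply: eq_bigr => g _.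
  by rewrite mulrA.
transitivity (\sum_f E b f * \sum_a W a j *
    tens_spin i a (fun h => \sum_g tens_pow_coef W h g * E d g) f).
  by apply: eq_bigr => f _; rewrite tens_spin_pow.
under eq_bigr do rewrite mulr_sumr.
rewrite exchange_big; apply: eq_bigr => a _ /=; rewrite mxE [(_ *m _) _ _]mxE.
transitivity (W a j * \sum_f E b f *
   tens_spin i a (fun h => \sum_g tens_pow_coef W h g * E d g) f).
  by rewrite mulr_sumr; apply: eq_bigr => f _; rewrite mulrCA.
rewrite tens_spin_adj; congr (_ * _).
under eq_bigr do rewrite tens_spin_coef mulr_suml.
rewrite exchange_big; apply: eq_bigr => c _ /=.
rewrite sym_powE mulr_sumr; apply: eq_bigr => f _.
by rewrite (spin_mx_tr i a) mulrCA mulrA.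
Qed.

End SymPow.

(** * Change of basis in the auxiliary and quantum spaces *)

Section Gauge.
Variables (C : numClosedFieldType) (eta : C).
Variables (N : nat) (m : 'I_N -> nat) (xi : 'I_N -> C).
Local Notation q := (qdim m).
Variables (W : 'M[C]_2).
Hypothesis Wu : W \in unitmx.
Local Notation G := (gauge m W).

Lemma gauge_unit : G \in unitmx.
Proof.
suff : G *m gauge m (invmx W) = 1%:M by case/mulmx1_unit.
rewrite tens_mxM -(tens_mx1 C m); apply: eq_tens_mx => n.
by rewrite sym_powM mulmxV // sym_pow1.
Qed.

Definition gauge_mx : 'M['M[C]_q]_2 := \matrix_(i, j) (W i j *: G).

(** The scalar part of the Lax operator commutes trivially, and the spin part by [sym_pow_spin]. *)
Lemma gauge_Lax n la : GRing.comm gauge_mx (Lax m eta n la).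
Proof.
apply/matrixP => i j; rewrite !mx2M.
have H : G *m site (\sum_a W i a *: spin_mx C (m n) a j) =
         site (\sum_a W a j *: spin_mx C (m n) i a) *m G.
  apply: gauge_site; rewrite mulmx_sumr mulmx_suml.
  under eq_bigr do rewrite -scalemxAr; under [RHS]eq_bigr do rewrite -scalemxAl.
  exact: sym_pow_spin.
move: H; rewrite !sum2E !siteD !siteZ !mulmxDr !mulmxDl -!scalemxAr -!scalemxAl => H.
have gE k l : gauge_mx k l = W k l *: G by rewrite mxE.
rewrite !gE -!scalemxAl -!scalemxAr !LaxE !mulmxDr !mulmxDl -!scalemxAr -!scalemxAl.
rewrite mulmx1 mul1mx.
move: H; move: (G *m _) (G *m _) (_ *m G) (_ *m G) => p1 p2 p3 p4 H.
move: (gauge m W) {gE} => g.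
apply/matrixP => b d; have := congr1 (fun X : 'M[C]_q => X b d) H.
rewrite /= !mxE => Hbd.
transitivity (W i j * (la + eta / 2) * g b d + eta * (W i 0 * p2 b d + W i 1 * p1 b d)).
  by case: (ord2P j) => ->; rewrite /=; ring.
by rewrite Hbd; case: (ord2P i) => ->; rewrite /=; ring.
Qed.

Lemma gauge_chain r la : GRing.comm gauge_mx (chain eta m xi r la).
Proof. by apply: commr_prod => n _; apply: gauge_Lax. Qed.

Lemma transfer_tr K la : transfer m eta xi K la =
  \sum_a \sum_b K a b *: chain eta m xi [seq rev_ord n | n <- index_enum 'I_N] la b a.
Proof.
rewrite /transfer monE; apply: eq_bigr => a _; rewrite mx2M; apply: eq_bigr => b _.
by rewrite mxE mul_scalar_mx.
Qed.

(** Commutation with the chain carries $W$ around the auxiliary trace, where it undoes the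
    conjugation of the twist. *)
Lemma gauge_transfer K la :
  G *m transfer m eta xi (invmx W *m K *m W) la = transfer m eta xi K la *m G.
Proof.
rewrite !transfer_tr; set c := chain _ _ _ _ _.
have Hc d a : \sum_b W d b *: (G *m c b a) = \sum_b W b a *: (c d b *m G).
  transitivity ((gauge_mx * c) d a).
    by rewrite mx2M; apply: eq_bigr => b _; rewrite mxE scalemxAl.
  rewrite (gauge_chain _ la : gauge_mx * c = c * gauge_mx) mx2M.
  by apply: eq_bigr => b _; rewrite mxE scalemxAr.
rewrite mulmx_sumr mulmx_suml.
transitivity (\sum_a \sum_d (invmx W *m K) a d *: \sum_b W d b *: (G *m c b a)).
  apply: eq_bigr => a _; rewrite mulmx_sumr.
  under eq_bigr do rewrite -scalemxAr mxE scaler_suml.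
  rewrite exchange_big; apply: eq_bigr => d _ /=; rewrite scaler_sumr.
  by apply: eq_bigr => b _; rewrite scalerA.
transitivity (\sum_b \sum_d K b d *: (c d b *m G)); last first.
  by apply: eq_bigr => b _; rewrite mulmx_suml; apply: eq_bigr => d _; rewrite -scalemxAl.
transitivity (\sum_b \sum_d (W *m (invmx W *m K)) b d *: (c d b *m G)); last first.
  by rewrite mulKVmx.
under eq_bigr do under eq_bigr do rewrite Hc scaler_sumr.
rewrite exchange_big [RHS]exchange_big; apply: eq_bigr => d _ /=.
rewrite exchange_big; apply: eq_bigr => b _ /=.
rewrite [(W *m _) b d]mxE scaler_suml; apply: eq_bigr => a _.
by rewrite scalerA mulrC.
Qed.

End Gauge.

(** * Separation of variables *)

Section LinearAlgebra.
Variable F : fieldType.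

Lemma det2E (K : 'M[F]_2) : \det K = K 1 1 * K 0 0 - K 1 0 * K 0 1.
Proof.
rewrite (expand_det_row K 0) sum2E /cofactor !det_mx11 !mxE /=.
have -> : lift 0 0 = 1 :> 'I_2 by apply/val_inj.
have -> : lift 1 0 = 0 :> 'I_2 by apply/val_inj.
by rewrite expr0 expr1; ring.
Qed.

Lemma eigenvalue2 (K : 'M[F]_2) a : eigenvalue K a ->
  (K 0 0 - a) * (K 1 1 - a) = K 1 0 * K 0 1.
Proof.
case/eigenvalueP=> v vK v0.
have e0 := congr1 (fun w : 'rV[F]_2 => w 0 0) vK.
have e1 := congr1 (fun w : 'rV[F]_2 => w 0 1) vK.
move: e0 e1; rewrite /= !mxE !sum2E; set x := v 0 0; set y := v 0 1 => e0 e1.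
have X0 : x * (K 0 0 - a) = - (y * K 1 0).
  by rewrite mulrBr [x * a]mulrC -e0; ring.
have Y0 : y * (K 1 1 - a) = - (x * K 0 1).
  by rewrite mulrBr [y * a]mulrC -e1; ring.
have [x0 | nx0] := eqVneq x 0; last first.
  apply: (mulfI nx0); rewrite mulrA X0.
  by rewrite mulNr mulrAC Y0; ring.
have y0 : y != 0.
  apply: contraNneq v0 => y0; apply/eqP/rowP => j; rewrite mxE.
  by case: (ord2P j) => ->.
apply: (mulfI y0); rewrite mulrCA Y0.
by rewrite mulrN mulrA [_ * x]mulrC X0; ring.
Qed.

(** Subtracting the two characteristic equations gives the trace as $a+b$; either of them then gives
    the determinant. *)
Lemma det_eigenvalues (K : 'M[F]_2) a b : a != b -> eigenvalue K a -> eigenvalue K b ->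
  \det K = a * b.
Proof.
rewrite det2E -subr_eq0 => ab /eigenvalue2 Ka /eigenvalue2 Kb.
rewrite -Ka.
have : (a - b) * (a + b - (K 0 0 + K 1 1)) = 0.
  transitivity ((K 0 0 - a) * (K 1 1 - a) - (K 0 0 - b) * (K 1 1 - b)); first by ring.
  by rewrite Ka Kb subrr.
move=> /eqP; rewrite mulf_eq0 (negPf ab) /= subr_eq0 => /eqP E.
transitivity (a * (K 0 0 + K 1 1) - a * a); first by ring.
by rewrite -E; ring.
Qed.

Lemma codom_basis (I : finType) (vT : vectType F) (f : I -> vT) :
  dim vT = #|I| -> (forall c : I -> F, \sum_i c i *: f i = 0 -> forall i, c i = 0) ->
  basis_of fullv (codom f).
Proof.
move=> dI fr; rewrite basisEfree subvf dimvf size_codom dI leqnn !andbT.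
apply/(freeP (X := codom_tuple f)) => k k0 i.
rewrite -(enum_valK i); apply: (fr (fun l => k (enum_rank l))).
rewrite -[RHS]k0 (reindex (@enum_rank I)); last exact/onW_bij/enum_rank_bij.
by apply: eq_bigr => l _; rewrite /= nth_codom enum_rankK.
Qed.

Lemma codom_span (I : finType) (vT : vectType F) (f : I -> vT) (v : vT) :
  basis_of fullv (codom f) -> exists a : I -> F, v = \sum_i a i *: f i.
Proof.
move=> fB; exists (fun i => coord (codom_tuple f) (enum_rank i) v).
rewrite [LHS](coord_basis (X := codom_tuple f) fB (memvf v)).
rewrite (reindex (@enum_rank I)); last exact/onW_bij/enum_rank_bij.
by apply: eq_bigr => l _; rewrite /= nth_codom enum_rankK.
Qed.

Lemma codom_free (I : finType) (vT : vectType F) (f : I -> vT) :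
  basis_of fullv (codom f) ->
  forall c : I -> F, \sum_i c i *: f i = 0 -> forall i, c i = 0.
Proof.
move=> /basis_free/(freeP (X := codom_tuple f)) fr c c0 i.
rewrite -(enum_rankK i); apply: (fr (fun l => c (enum_val l))).
rewrite -[RHS]c0 (reindex (@enum_rank I)); last exact/onW_bij/enum_rank_bij.
by apply: eq_bigr => l _; rewrite /= nth_codom enum_rankK.
Qed.

Lemma mul_row_delta q (u : 'rV[F]_q) j : (u *m delta_mx j 0 : 'M_1) 0 0 = u 0 j.
Proof. by rewrite -colE mxE. Qed.

Lemma row_eq_on_basis (I : finType) q (e : I -> 'cV[F]_q) (u w : 'rV[F]_q) :
  basis_of fullv (codom e) -> (forall i, u *m e i = w *m e i) -> u = w.
Proof.
move=> eB ue; apply/rowP => j; rewrite -(mul_row_delta u) -(mul_row_delta w).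
have [a ->] := codom_span (delta_mx j 0) eB.
by rewrite !mulmx_sumr; congr (fun_of_matrix _ 0 0); apply: eq_bigr => i _;
  rewrite -!scalemxAr ue.
Qed.

Lemma col_eq0_on_basis (I : finType) q (f : I -> 'rV[F]_q) (v : 'cV[F]_q) :
  basis_of fullv (codom f) -> (forall i, f i *m v = 0) -> v = 0.
Proof.
move=> fB fv; apply/colP => j; rewrite [RHS]mxE.
have -> : v j 0 = (delta_mx 0 j *m v : 'M_1) 0 0 by rewrite -rowE mxE.
have [a ->] := codom_span (delta_mx 0 j) fB.
by rewrite mulmx_suml big1 ?mxE // => i _; rewrite -scalemxAl fv scaler0.
Qed.

Lemma prod_eigen q (I : Type) (r : seq I) (A : I -> 'M[F]_q) (c : I -> F) (v : 'cV[F]_q) :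
  (forall i, A i *m v = c i *: v) ->
  (\prod_(i <- r) A i) *m v = (\prod_(i <- r) c i) *: v.
Proof.
move=> Av; elim: r => [|i r IH]; first by rewrite !big_nil mul1mx scale1r.
by rewrite !big_cons -mulmxA IH -scalemxAr Av scalerA mulrC.
Qed.

End LinearAlgebra.

(** In characteristic zero the naturals supply as many distinct roots of [p - r] as its size, one
    too many for a nonzero polynomial. *)
Lemma poly_eq (R : numDomainType) (p r : {poly R}) : (forall x, p.[x] = r.[x]) -> p = r.
Proof.
move=> pr; apply/eqP; rewrite -subr_eq0; apply: contraT => d0.
have := max_poly_roots d0 (rs := [seq k%:R | k <- iota 0 (size (p - r))]).
rewrite size_map size_iota ltnn => -> //.
  by apply/allP => x _; rewrite rootE !hornerE pr subrr.
by rewrite map_inj_uniq ?iota_uniq // => a b /eqP; rewrite eqr_nat => /eqP.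
Qed.

(** * Bases with factorized wavefunctions *)

Section SoV.
Variables (C : numClosedFieldType) (eta : C) (eta0 : eta != 0).
Variables (N : nat) (m : 'I_N -> nat) (xi : 'I_N -> C).
Local Notation q := (qdim m).
Local Notation label := (label m).
Local Notation xish := (xish m eta xi).
Local Notation afun := (afun m eta xi).
Local Notation dfun := (dfun m eta xi).
Variables (k1 k2 : C).
Hypotheses (k10 : k1 != 0) (k20 : k2 != 0).
Hypothesis xi_gen : generic_xi eta m xi.

(* Covectors in which the wave functions factorise up to a factor that may
   vanish, the form in which the discrete TQ equation yields it. *)
Definition SoV_frame (K : 'M[C]_2) (s : label -> 'rV[C]_q) : Prop :=
  basis_of fullv (codom s) /\
  forall t v Qt, transfer_eigenvector eta xi K t v ->
    TQ_solution m eta xi k1 k2 t Qt ->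
    exists c, forall l, (s l *m v) 0 0 = c * \prod_n Qt.[xish n (l n)].

Lemma dim_rV : dim 'rV[C]_q = #|{: label}|.
Proof. by rewrite dim_matrix; apply: mul1n. Qed.

Lemma Sklyanin_frame K : \det K = k1 * k2 -> K 0 1 != 0 ->
  SoV_frame K (Sklyanin_covector m eta xi k1 K).
Proof.
rewrite det2E => detK K01; split.
  by apply: codom_basis dim_rV _; apply: (Sk_vec_free eta0 xi_gen k10 k20 detK K01).
move=> t v Qt tv TQ; have Q0 := TQ_bottom_neq0 eta0 xi_gen k10 TQ.
(* The constant is fixed by the label with all entries 0, whose covector is $\langle0|$. *)
exists ((covac C m *m v) 0 0 / \prod_n Qt.[xish n 0]) => l.
have P0 : \prod_n Qt.[xish n 0] != 0 by apply/prodf_neq0.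
pose h := [ffun n => l n : nat].
have hm n : (h n <= m n)%N by rewrite ffunE -ltnS.
have := Sk_vec_wave eta0 xi_gen k10 detK tv TQ hm.
have -> : Sk_vec eta m xi K k1 h = Sklyanin_covector m eta xi k1 K l.
  by congr (_ *m _); apply: eq_bigr => n _; rewrite ffunE.
have -> : \prod_n Qt.[xish n (h n)] = \prod_n Qt.[xish n (l n)].
  by apply: eq_bigr => n _; rewrite ffunE.
by move=> H; apply: (mulIf P0); rewrite H mulrAC divfK.
Qed.

Lemma Sklyanin_gauged_frame K W : \det K = k1 * k2 -> W \in unitmx ->
  (invmx W *m K *m W) 0 1 != 0 ->
  SoV_frame K (Sklyanin_covector_gauged m eta xi k1 K W).
Proof.
move=> detK Wu K01; pose Kb := invmx W *m K *m W.
have detKb : \det Kb = k1 * k2.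
  by rewrite !det_mulmx mulrAC -det_mulmx mulVmx // det1 mul1r.
have [sB sw] := Sklyanin_frame detKb K01.
have Gu := gauge_unit m Wu; split.
  apply: codom_basis dim_rV _ => c c0 i; apply: (codom_free sB).
  apply: (can_inj (mulmxKV Gu)); rewrite /= mul0mx mulmx_suml -[RHS]c0.
  by apply: eq_bigr => l _; rewrite -scalemxAl.
move=> t v Qt [v0 Tv] TQ.
have tv : transfer_eigenvector eta xi Kb t (invmx (gauge m W) *m v).
  split; first by apply: contraNneq v0 => e; rewrite -(mulKVmx Gu v) e mulmx0.
  move=> la; apply: (can_inj (mulKmx Gu)).
  by rewrite mulmxA gauge_transfer // -scalemxAr -!mulmxA mulKVmx // Tv mulKVmx.
have [c cE] := sw _ _ _ tv TQ; exists c => l.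
by rewrite -cE mulmxA.
Qed.

(** If $K_{12}=0$, one conjugates by a unipotent matrix with parameter $1$ or $-1$. Were both to
    leave the upper entry zero, the diagonal entries of the triangular [K] would agree, forcing
    $\mathsf k_1=\mathsf k_2$. *)
Lemma exists_frame K : k1 != k2 -> eigenvalue K k1 -> eigenvalue K k2 ->
  exists s, SoV_frame K s.
Proof.
move=> k12 E1 E2; have detK := det_eigenvalues k12 E1 E2.
have [K01 | K01] := eqVneq (K 0 1) 0; last first.
  by exists (Sklyanin_covector m eta xi k1 K); apply: Sklyanin_frame.
pose V (x : C) : 'M[C]_2 := \matrix_(i, j) if i == j then 1 else if i == 0 then x else 0.
have V2 x y : V x *m V y = V (x + y).
  apply/matrixP => i j; rewrite mxE sum2E !mxE.
  by case: (ord2P i) => ->; case: (ord2P j) => -> /=; ring.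
have V0 : V 0 = 1%:M.
  by apply/matrixP => i j; rewrite !mxE; case: eqP => //; case: ifP.
have Vu x : V x \in unitmx.
  suff : V x *m V (- x) = 1%:M by case/mulmx1_unit.
  by rewrite V2 subrr.
have Vi x : invmx (V x) = V (- x).
  by apply: (can_inj (mulKmx (Vu x))); rewrite mulmxV // V2 subrr.
have VK x : (invmx (V x) *m K *m V x) 0 1 = x * (K 0 0 - K 1 1 - x * K 1 0).
  by rewrite Vi -!mulmxA !mxE !sum2E !mxE !sum2E !mxE /= K01; ring.
have [e1 | ?] := eqVneq ((invmx (V 1) *m K *m V 1) 0 1) 0; last first.
  by exists (Sklyanin_covector_gauged m eta xi k1 K (V 1)); apply: Sklyanin_gauged_frame.
have [e2 | ?] := eqVneq ((invmx (V (-1)) *m K *m V (-1)) 0 1) 0; last first.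
  by exists (Sklyanin_covector_gauged m eta xi k1 K (V (-1))); apply: Sklyanin_gauged_frame.
have K0011 : K 0 0 = K 1 1.
  move: e1 e2; rewrite !VK => e1 e2; have n2 : 2 != 0 :> C by rewrite pnatr_eq0.
  apply/eqP; rewrite -subr_eq0; apply/eqP/(mulfI n2); rewrite mulr0.
  transitivity (1 * (K 0 0 - K 1 1 - 1 * K 1 0) - (-1) * (K 0 0 - K 1 1 - (-1) * K 1 0)).
    by ring.
  by rewrite e1 e2 subrr.
case/eqP: k12.
have D x : eigenvalue K x -> K 0 0 - x = 0.
  move/eigenvalue2; rewrite -K0011 K01 mulr0 => /eqP.
  by rewrite mulf_eq0 orbb => /eqP.
by apply: (addrI (- K 0 0)); rewrite ![- K 0 0 + _]addrC -!(opprB (K 0 0)) !D.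
Qed.

(** * The Q-operator and the fused transfer matrices on the eigenbasis *)

Section Operator.
Variables (K : 'M[C]_2) (Qt : {poly C} -> {poly C}) (Q : C -> 'M[C]_q).
Variables (t : label -> {poly C}) (e : label -> 'cV[C]_q).
Hypothesis detK : \det K = k1 * k2.
Hypothesis te : transfer_eigenbasis eta xi K t e.
Hypothesis TQ : forall i, TQ_solution m eta xi k1 k2 (t i) (Qt (t i)).
Hypothesis QE : forall i la, Q la *m e i = (Qt (t i)).[la] *: e i.

Let eB : basis_of fullv (codom e).
Proof. by case: te. Qed.

(** Components of [v] along eigenvectors of another eigenvalue vanish, and simplicity of the
    spectrum leaves just one. *)
Lemma eigenvector_classify t' v : transfer_eigenvector eta xi K t' v ->
  exists i a, [/\ a != 0, t' = t i & v = a *: e i].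
Proof.
move=> [v0 Tv]; have [_ tI eT] := te.
have [a va] := codom_span v eB.
have H i : a i != 0 -> t' = t i.
  move=> ai; apply: poly_eq => la.
  have : \sum_j (a j * ((t j).[la] - t'.[la])) *: e j = 0.
    under eq_bigr do rewrite mulrBr scalerBl.
    rewrite sumrB; apply/eqP; rewrite subr_eq0; apply/eqP.
    transitivity (transfer m eta xi K la *m v).
      rewrite va mulmx_sumr; apply: eq_bigr => j _; rewrite -scalemxAr.
      by rewrite (proj2 (eT j)) scalerA.
    by rewrite Tv va scaler_sumr; apply: eq_bigr => j _; rewrite scalerA mulrC.
  move/(codom_free eB)/(_ i)/eqP.
  by rewrite mulf_eq0 (negPf ai) subr_eq0 => /eqP ->.
have [i ai] : exists i, a i != 0.
  apply/existsP; apply: contraNT v0; rewrite negb_exists => /forallP a0.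
  rewrite va big1 // => i _; move: (a0 i); rewrite negbK => /eqP ->.
  exact: scale0r.
exists i, (a i); split=> //; first exact: H.
rewrite va (bigD1 i) //= big1 ?addr0 // => j ji.
have [-> | aj] := eqVneq (a j) 0; first exact: scale0r.
by case/eqP: ji; apply: tI; rewrite -(H _ aj) -(H _ ai).
Qed.

Lemma Qcov_eigen L l i :
  Q_covector m eta xi Q L l *m e i =
  (\prod_n (Qt (t i)).[xish n (l n)]) *: (L *m e i).
Proof.
by rewrite -mulmxA (prod_eigen _ (c := fun n => (Qt (t i)).[xish n (l n)])) -?scalemxAr.
Qed.

Lemma Q_unit n : Q (xish n (m n)) \in unitmx.
Proof.
(* A row in the kernel annihilates every [e i], on which the operator has a nonzero eigenvalue. *)
rewrite -row_free_unit -kermx_eq0; apply/eqP/row_matrixP => j.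
rewrite row0; apply: (row_eq_on_basis eB) => i; rewrite mul0mx.
have [_ Qm _] := TQ i; apply: (scalerI (Qm n)).
rewrite scaler0 scalemxAr -QE mulmxA.
by rewrite -row_mul mulmx_ker row0 mul0mx.
Qed.

Lemma invQ_eigen n i :
  invmx (Q (xish n (m n))) *m e i = (Qt (t i)).[xish n (m n)]^-1 *: e i.
Proof.
have [_ Qm _] := TQ i; apply: (scalerI (Qm n)).
rewrite scalerA divff // scale1r scalemxAr -QE mulmxA mulVmx ?mul1mx //.
exact: Q_unit.
Qed.

Definition invQ_covector S : 'rV[C]_q := S *m \prod_n invmx (Q (xish n (m n))).

Lemma invQ_covector_eigen S l i :
  Q_covector m eta xi Q (invQ_covector S) l *m e i =
  (\prod_n ((Qt (t i)).[xish n (l n)] / (Qt (t i)).[xish n (m n)])) *: (S *m e i).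
Proof.
rewrite Qcov_eigen -mulmxA (prod_eigen _ (c := fun n => (Qt (t i)).[xish n (m n)]^-1)).
  by rewrite -scalemxAr scalerA -big_split.
by move=> n; apply: invQ_eigen.
Qed.

Lemma frame_SoV s : SoV_frame K s -> is_SoV_basis m eta xi K Qt s.
Proof.
move=> [sB sw]; split=> // t' v tv.
have [i [a [a0 ti va]]] := eigenvector_classify tv.
have [c cE] : exists c, forall l, (s l *m v) 0 0 = c * \prod_n (Qt t').[xish n (l n)].
  by apply: sw tv _; rewrite ti.
(* With $c=0$ all covectors of the basis would annihilate the nonzero eigenvector. *)
have c0 : c != 0.
  apply: contraNneq (proj1 tv) => c0; apply/eqP/(col_eq0_on_basis sB) => l.
  by apply/matrixP => x y; rewrite !ord1 cE c0 mul0r mxE.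
exists c^-1; first by rewrite invr_eq0.
by move=> l; rewrite -scalemxAr mxE cE mulKf.
Qed.

(** The top label gives $c\prod_nQ_t(\xi_n^{(2s_n)})$ on each eigenvector; the Q-operators replace
    this product by the one at [l], with the same $c$. *)
Lemma frame_Qcov s l : SoV_frame K s ->
  Q_covector m eta xi Q (invQ_covector (s (label_max m))) l = s l.
Proof.
move=> [_ sw]; have [_ _ eT] := te; apply: (row_eq_on_basis eB) => i.
rewrite invQ_covector_eigen.
have [c cE] := sw _ _ _ (eT i) (TQ i).
apply/matrixP => x y; rewrite !ord1 mxE !cE mulrCA -big_split; congr (_ * _).
apply: eq_bigr => n _; rewrite /= ffunE /= divfK //.
by have [_ Qm _] := TQ i.
Qed.

Lemma generic_SoV s L : SoV_frame K s -> (forall i, (L *m e i) 0 0 != 0) ->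
  is_SoV_basis m eta xi K Qt (Q_covector m eta xi Q L).
Proof.
move=> [sB sw] L0; have [_ _ eT] := te; split.
  apply: codom_basis dim_rV _ => c c0; apply: (codom_free sB).
  apply: (row_eq_on_basis eB) => i; rewrite mul0mx.
  have [d dE] := sw _ _ _ (eT i) (TQ i).
  (* A relation among the Q-covectors, paired with [e i] and divided by the nonzero $\langle
     L|e_i\rangle$, is a relation among the rows of Q-values, hence among the frame. *)
  have /eqP : (\sum_l c l * \prod_n (Qt (t i)).[xish n (l n)]) * (L *m e i) 0 0 = 0.
    transitivity (((\sum_l c l *: Q_covector m eta xi Q L l) *m e i) 0 0); last first.
      by rewrite c0 mul0mx mxE.
    rewrite mulmx_suml summxE mulr_suml; apply: eq_bigr => l _.
    by rewrite -scalemxAl Qcov_eigen scalerA [RHS]mxE.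
  rewrite mulf_eq0 (negPf (L0 i)) orbF => /eqP H.
  apply/matrixP => x y; rewrite !ord1 mulmx_suml summxE [RHS]mxE.
  rewrite (eq_bigr (fun l => d * (c l * \prod_n (Qt (t i)).[xish n (l n)]))) => [|l _].
    by rewrite -mulr_sumr H mulr0.
  by rewrite -scalemxAl mxE dE mulrCA.
move=> t' v tv; have [i [a [a0 -> ->]]] := eigenvector_classify tv.
exists (a * (L *m e i) 0 0)^-1; first by rewrite invr_eq0 mulf_neq0.
move=> l; rewrite -!scalemxAr Qcov_eigen !scalerA mxE.
by have := L0 i => ?; field; apply/andP.
Qed.

(** Two-step induction on the fusion recursion. It starts from $a(\xi_n^{(2s_n)})=0$, which leaves
    only the $d$ term in the TQ equation. *)
Lemma fused_eigen n l i : (l <= m n)%N ->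
  fused_transfer m eta xi K l (xish n (m n)) *m e i =
  ((\prod_(k < l) (k2 * dfun (xish n (m n - k)))) *
    ((Qt (t i)).[xish n (m n - l)] / (Qt (t i)).[xish n (m n)])) *: e i.
Proof.
have [_ Qm tq] := TQ i; have [_ _ /(_ i)[_ eT]] := te.
rewrite fused_transferE //; set x := xish n (m n); set p := Qt (t i) in Qm tq *.
have p0 : p.[x] != 0 := Qm n.
have xE j : (j <= m n)%N -> xish n (m n - j) = x + j%:R * eta.
  by move=> jm; rewrite (@xishB C eta N m xi n _ _ (leq_subr j (m n))) subKn.
have [k] := ubnP l; elim: k l => // k IH [|[|l]] lk lm.
- by rewrite symtrace0 mul1mx big_ord0 subn0 divff // mul1r scale1r.
- rewrite symtrace1 -transferE eT; congr (_ *: _).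
  rewrite big_ord1 subn0 xE // mul1r; apply: (mulIf p0).
  by rewrite tq afun_max mulr0 mul0r add0r mulrA divfK // mulrA.
have [lm1 lm2] : (l.+1 <= m n)%N /\ (l <= m n)%N by split; lia.
rewrite (symtrace_rec eta0 (RTT_mon eta m xi K)) -transferE mulmxBl -!mulmxA.
rewrite !IH ?(ltnW lm1) //; try lia.
rewrite -scalemxAr eT qdet_mon // -det2E detK -scalemxAr mul_scalar_mx.
set u := x + l%:R * eta.
rewrite !big_ord_recr /= !xE // -/u.
have -> : x + l.+1%:R * eta = u + eta by rewrite /u -addn1 natrD; ring.
have -> : x + l.+2%:R * eta = u + eta + eta by rewrite /u -addn2 natrD; ring.
rewrite !scalerA -scalerBl; congr (_ *: _).
(* The quantum determinant contributes exactly the $a$ term of the TQ equation at $u+\eta$, leaving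
   the $d$ term as the next factor. *)
have := tq (u + eta); rewrite addrK => /(canLR (addKr _)) tqu.
set P := \prod_(k0 < l) _.
transitivity (P * (k2 * dfun u) / p.[x] *
  (- (k1 * afun (u + eta) * p.[u]) + (t i).[u + eta] * p.[u + eta])); first by ring.
by rewrite tqu; ring.
Qed.

Lemma fused_covector_eigen S l i :
  fused_covector m eta xi k2 K S l *m e i =
  (\prod_n ((Qt (t i)).[xish n (l n)] / (Qt (t i)).[xish n (m n)])) *: (S *m e i).
Proof.
rewrite -mulmxA (prod_eigen _ (c := fun n => (Qt (t i)).[xish n (l n)] /
  (Qt (t i)).[xish n (m n)])) -?scalemxAr // => n.
have lm : (l n <= m n)%N by rewrite -ltnS.
rewrite -scalemxAl fused_eigen ?leq_subr // scalerA subKn //; congr (_ *: _).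
(* The exponent $h_n-2s_n$ is nonpositive: the inverse power of [k2] cancels one factor per fusion
   step. *)
rewrite -opprB subzn // -exprnN big_split prodr_const card_ord /=.
have d0 : \prod_(k < m n - l n) dfun (xish n (m n - k)) != 0.
  apply/prodf_neq0 => k _; apply: dfun_neq0 => //.
  by have := ltn_ord k; lia.
have k0 : k2 ^+ (m n - l n) != 0 by rewrite expf_neq0.
have [_ Qm _] := TQ i; have := Qm n => ?.
by field; rewrite d0 k0; apply/and3P.
Qed.

Lemma Qcov_fused S l :
  Q_covector m eta xi Q (invQ_covector S) l = fused_covector m eta xi k2 K S l.
Proof.
apply: (row_eq_on_basis eB) => i.
by rewrite invQ_covector_eigen fused_covector_eigen.
Qed.

Lemma almost_any_SoV s : SoV_frame K s -> almost_any (fun L : 'I_q -> C =>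
  is_SoV_basis m eta xi K Qt (Q_covector m eta xi Q (\row_j L j))).
Proof.
(* The polynomial is the product of the linear forms $L\mapsto\langle L|e_i\rangle$, each nonzero
   because $e_i\neq0$. *)
move=> sK; exists (\prod_(i : label) \sum_j (e i j 0)%:MP_[q] * 'X_j).
  apply/prodf_neq0 => i _; have [_ _ eT] := te.
  apply: contraNneq (proj1 (eT i)) => p0; apply/eqP/colP => j; rewrite [RHS]mxE.
  (* Evaluation at a coordinate vector reads off the entry [j] of [e i]. *)
  have := congr1 (meval (fun k => (k == j)%:R)) p0.
  rewrite raddf_sum meval0 (bigD1 j) //= big1 => [|k kj].
    by rewrite mevalM mevalC mevalXU eqxx mulr1 addr0.
  by rewrite mevalM mevalC mevalXU (negPf kj) mulr0.
move=> L; rewrite rmorph_prod => /prodf_neq0 L0.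
apply: (generic_SoV sK) => i; apply: contraNneq (L0 i isT) => Le.
rewrite -[X in _ == X]Le raddf_sum mxE; apply/eqP/eq_bigr => j _.
by rewrite /= mevalM mevalC mevalXU mxE mulrC.
Qed.

End Operator.
End SoV.

(** * Genericity of the inhomogeneities and conclusion *)

Lemma almost_any_generic_xi (C : numClosedFieldType) (eta : C) (N : nat)
    (m : 'I_N -> nat) :
  almost_any (fun par : 'I_(2 + N) -> C =>
    generic_xi eta m (fun n => par (rshift 2 n))).
Proof.
(* The part of $\xi_n^{(k)}-\xi_p^{(l)}$ that is independent of the inhomogeneities. *)
pose c n k p l : C := xish m eta (fun=> 0) n k - xish m eta (fun=> 0) p l.
pose F n k p l : {mpoly C[2 + N]} :=
  'X_(rshift 2 n) - 'X_(rshift 2 p) + (c n k p l)%:MP.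
exists (\prod_(np : 'I_N * 'I_N | np.1 != np.2)
  \prod_(k < (m np.1).+1) \prod_(l < (m np.2).+1) F np.1 k np.2 l).
  apply/prodf_neq0; case=> n p /= np; apply/prodf_neq0 => k _; apply/prodf_neq0 => l _.
  (* At this point the factor takes the value 1. *)
  apply/eqP => /(congr1 (meval (fun i => if i == rshift 2 n then 1 - c n k p l else 0))).
  rewrite meval0 mevalD mevalB !mevalXU mevalC eqxx.
  rewrite (inj_eq (@rshift_inj _ _)) eq_sym (negPf np) subr0 subrK => /eqP.
  by rewrite oner_eq0.
move=> x; rewrite rmorph_prod => /prodf_neq0 H n p k l np km lm.
move: (H (n, p) np); rewrite rmorph_prod => /prodf_neq0.
move=> /(_ (Ordinal (km : (k < (m n).+1)%N)) isT); rewrite rmorph_prod => /prodf_neq0.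
move=> /(_ (Ordinal (lm : (l < (m p).+1)%N)) isT).
rewrite /= mevalD mevalB !mevalXU mevalC => F0; rewrite -subr_eq0.
rewrite (_ : _ - _ = x (rshift 2 n) - x (rshift 2 p) + c n k p l) //.
by rewrite /c /xish; ring.
Qed.

Theorem corollary5p2 (R : realType) (eta : R[i]) (heta : eta != 0)
    (N : nat) (hN : (0 < N)%N)
    (m : 'I_N -> nat) (hm : forall n : 'I_N, (0 < m n)%N) :
  almost_any (fun par : 'I_(2 + N) -> R[i] =>
    let k1 := par (lshift N 0) in
    let k2 := par (lshift N 1) in
    let xi := fun n : 'I_N => par (rshift 2 n) in
    k1 != k2 -> k1 != 0 -> k2 != 0 ->
    forall K : 'M[R[i]]_2, eigenvalue K k1 -> eigenvalue K k2 ->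
    forall (zeta : R[i]) (Qt : {poly R[i]} -> {poly R[i]})
      (Q : R[i] -> 'M[R[i]]_(qdim m)),
    is_Q_operator m eta xi k1 k2 K zeta Qt Q ->
    almost_any (fun l : 'I_(qdim m) -> R[i] =>
      is_SoV_basis m eta xi K Qt (Q_covector m eta xi Q (\row_j l j))) /\
    forall S : 'rV[R[i]]_(qdim m),
    let L := S *m \prod_(n < N) invmx (Q (xish m eta xi n (m n))) in
    [/\ forall h : label m,
          Q_covector m eta xi Q L h = fused_covector m eta xi k2 K S h,
        K 0 1 != 0 ->
        S = Sklyanin_covector m eta xi k1 K (label_max m) ->
        is_SoV_basis m eta xi K Qt (Sklyanin_covector m eta xi k1 K) /\
        forall h : label m,
          Q_covector m eta xi Q L h = Sklyanin_covector m eta xi k1 K h &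
        K 0 1 = 0 ->
        forall W : 'M[R[i]]_2, W \in unitmx ->
        (invmx W *m K *m W) 0 1 != 0 -> (invmx W *m K *m W) 1 0 != 0 ->
        S = Sklyanin_covector_gauged m eta xi k1 K W (label_max m) ->
        is_SoV_basis m eta xi K Qt (Sklyanin_covector_gauged m eta xi k1 K W) /\
        forall h : label m,
          Q_covector m eta xi Q L h =
          Sklyanin_covector_gauged m eta xi k1 K W h]).

Proof.
have [p p0 pP] := almost_any_generic_xi eta m; exists p => // par /pP xi_gen k1 k2 xi.
move=> k12 k10 k20 K E1 E2 zeta Qt Q [t [e [te H]]].
have detK := det_eigenvalues k12 E1 E2.
have TQ i : TQ_solution m eta xi k1 k2 (t i) (Qt (t i)) by case: (H i).
have QE i la : Q la *m e i = (Qt (t i)).[la] *: e i by case: (H i).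
split.
  (* Any frame serves here: it witnesses that the matrix of the products $\prod_nQ_t(\xi_n^{(h_n)})$
     is invertible. *)
  have [s sK] := exists_frame heta k10 k20 xi_gen k12 E1 E2.
  exact: (almost_any_SoV te TQ QE sK).
move=> S L; split.
- by move=> h; apply: (Qcov_fused heta k10 k20 xi_gen detK te TQ QE).
- move=> K01 SE; have sK := Sklyanin_frame heta k10 k20 xi_gen detK K01.
  split; first exact: (frame_SoV te TQ sK).
  by move=> h; rewrite /L SE; apply: (frame_Qcov te TQ QE h sK).
move=> _ W Wu W01 _ SE.
have sK := Sklyanin_gauged_frame heta k10 k20 xi_gen detK Wu W01.
split; first exact: (frame_SoV te TQ sK).
by move=> h; rewrite /L SE; apply: (frame_Qcov te TQ QE h sK).
Qed.
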